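(* Given integers $\chi\geq 2$ and $m\geq 2$ and a real number $\varepsilon>0$, there exists an integer $n_0=n_0(\chi,m,\varepsilon)$ such that for all $n\geq n_0$, $$R(P^{(3)}_{n,2},H(TT_\chi,m))\leq\begin{cases}(1+\varepsilon)n & \text{if }\chi=2,\\ \left(\frac23+\varepsilon\right)(\vec{R}(\chi)-1)n & \text{if }\chi\geq 3.\end{cases}$$
   Context: $TT_\chi$ denotes the transitive (acyclic) tournament on $[\chi]$. For a tournament $T_\chi$ on $[\chi]$ and $m\ge1$, $H(T_\chi,m)$ is the $3$-uniform hypergraph whose vertex set is partitioned into sets $A_1,\dots,A_\chi$ each of size $m$, with edge set $\{xyz: x,y\in A_i,\ z\in A_j,\ (i,j)\text{ an arc of }T_\chi\}$. $\vec{R}(\ell)$ is the least $N$ such that every tournament on at least $N$ vertices contains a copy of $TT_\ell$. $R(G,H)$ is the least $N$ such that every red/blue colouring of the edges of $K^{(3)}_N$ contains a red copy of $G$ or a blue copy of $H$. The tight path $P^{(3)}_{n,2}$ has vertices $v_1,\dots,v_n$ and edges $\{v_i,v_{i+1},v_{i+2}\}$, $i\in[n-2]$. *)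

(* Defs.v *)
From Stdlib Require Import Reals ClassicalEpsilon.
From mathcomp Require Import all_boot.

Set Implicit Arguments.
Unset Strict Implicit.
Unset Printing Implicit Defensive.

(* Least natural number satisfying a (Prop) property; 0 if none exists
   (for all uses below existence holds by Ramsey-type theorems). *)
Definition leastP (P : nat -> Prop) : nat :=
  let p : pred nat := fun n => if excluded_middle_informative (P n) then true else false in
  match excluded_middle_informative (exists n, p n) with
  | left h => ex_minn h
  | right _ => 0
  end.

Record hypergraph3 := Hyp3 {
  hvert : finType;
  hedges : {set {set hvert}}
}.
(* (3-uniformity holds by construction for the concrete hypergraphs below.) *)

(* A red/blue colouring of the edges of K^(3)_N: colour of 3-subsets
   (true = red, false = blue; values on non-3-subsets are irrelevant). *)
Definition colouring (N : nat) := {set 'I_N} -> bool.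

Definition has_mono_copy (N : nat) (c : colouring N) (b : bool) (G : hypergraph3) : Prop :=
  exists f : hvert G -> 'I_N, injective f /\
    forall e, e \in hedges G -> c (f @: e) = b.

Definition ramsey3 (G H : hypergraph3) : nat :=
  leastP (fun N => forall c : colouring N,
            has_mono_copy c true G \/ has_mono_copy c false H).

Definition is_tournament (N : nat) (T : rel 'I_N) : Prop :=
  (forall i, ~~ T i i) /\ (forall i j, i != j -> T i j (+) T j i).

Definition TT (l : nat) : rel 'I_l := fun i j => i < j.

Definition contains_TT (N : nat) (T : rel 'I_N) (l : nat) : Prop :=
  exists f : 'I_l -> 'I_N, injective f /\ forall i j : 'I_l, i < j -> T (f i) (f j).

Definition tourn_ramsey (l : nat) : nat :=
  leastP (fun N => forall M, N <= M -> forall T : rel 'I_M,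
            is_tournament T -> contains_TT T l).

Definition tight_path_edges (n : nat) : {set {set 'I_n}} :=
  [set e : {set 'I_n} | [exists i : 'I_n, exists j : 'I_n, exists k : 'I_n,
      [&& j == i.+1 :> nat, k == i.+2 :> nat & e == [set i; j; k]]]].

Definition tight_path (n : nat) : hypergraph3 := @Hyp3 'I_n (tight_path_edges n).

Definition Hblowup_edges (chi m : nat) (T : rel 'I_chi) : {set {set ('I_chi * 'I_m)}} :=
  [set e : {set ('I_chi * 'I_m)} | [exists x, exists y, exists z,
      [&& x != y, x.1 == y.1, T x.1 z.1 & e == [set x; y; z]]]].

Definition Hblowup (chi m : nat) (T : rel 'I_chi) : hypergraph3 :=
  @Hyp3 ('I_chi * 'I_m)%type (Hblowup_edges m T).

(* Main.v *)
(* Assume there is no blue H(TT_chi, m), and let r = R(chi) - 1. By Ramsey's theorem all but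
   boundedly many vertices can be partitioned into red cliques of a large constant size t. Call
   two cliques linked if a red tight path leads from one to the other robustly. Between two
   cliques that are not linked one finds, by bipartite Ramsey, large subsets X, Y with all XXY
   triples blue or all XYY triples blue; so r + 1 pairwise unlinked cliques would give a
   tournament, hence a TT_chi, hence a blue H(TT_chi, m). By the Gallai-Milgram argument the
   cliques are therefore covered by r paths of linked cliques, and one of these paths contains
   a fraction 1/r of the vertices. Following it gives a red tight path through all vertices of
   its cliques, which settles chi = 2.

   For chi >= 3 the factor 2/3 is gained by inserting, in each clique Q, vertices x outside the
   path of cliques, in the pattern v1 v2 x v3 v4 x' v5 v6 ...; this needs long red paths in the
   link of x on the unused part R of Q, and (by pigeonhole) many x with the same link. If this
   fails, then almost none of the at least |V| - n - O(1) unused vertices has a long red path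
   in its link on R. Since R(chi) >= R(chi - 1) + 2, induction on chi yields among them a blue
   H(TT_(chi-1), M) with M huge. A graph on R without a long path has large independent sets,
   also inside every large subset of R; hence some m vertices of R form the first class of a
   blue H(TT_chi, m). *)

Require Import Defs.
From Stdlib Require Import ZArith Reals Lra Classical ClassicalEpsilon.
From mathcomp Require Import all_boot zify.

Set Implicit Arguments.
Unset Strict Implicit.
Unset Printing Implicit Defensive.

(** * Finite Ramsey theory and path covers *)

Lemma pigeonhole_set (T K : finType) (f : T -> K) (A : {set T}) (B : {set K}) s :
  (forall x, x \in A -> f x \in B) -> #|B| * s < #|A| ->
  exists2 k, k \in B & s < #|[set x in A | f x == k]|.
Proof.
move=> fB lt; have [k|none] := pickP (fun k => (k \in B) && (s < #|[set x in A | f x == k]|)).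
  by case/andP; exists k.
suff: #|A| <= #|B| * s by rewrite leqNgt lt.
rewrite -sum1_card (partition_big f (mem B)) //= -sum_nat_const.
apply: leq_sum => k kB; move: (none k); rewrite kB /= => /negbT; rewrite -leqNgt.
by apply: leq_trans; rewrite -sum1_card; apply/eq_leq/eq_bigl => x; rewrite inE.
Qed.

Lemma subset_of_card (T : finType) (A : {set T}) n :
  n <= #|A| -> exists2 S : {set T}, S \subset A & #|S| = n.
Proof.
move=> le; exists [set x in take n (enum A)].
  by apply/subsetP => x; rewrite inE => /mem_take; rewrite mem_enum.
rewrite cardsE (card_uniqP _) ?take_uniq ?enum_uniq // size_takel //.
by rewrite -cardE.
Qed.

Definition mono (T : finType) (c : {set T} -> bool) b k (S : {set T}) :=
  forall e : {set T}, e \subset S -> #|e| = k -> c e = b.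

(** Ramsey's theorem for [k]-sets. A vertex [v] turns the colours of the [k.+1]-sets through [v]
    into a colouring of [k]-sets; inside a set monochromatic for the latter, induction on [a + b]
    finds the wanted set or one that lacks only [v]. *)
Lemma ramsey_sets k a b : exists N, forall (T : finType) (c : {set T} -> bool) (A : {set T}),
  N <= #|A| ->
  (exists S : {set T}, [/\ S \subset A, #|S| = a & mono c true k S]) \/
  (exists S : {set T}, [/\ S \subset A, #|S| = b & mono c false k S]).
Proof.
elim: k a b => [|k IHk] a b.
  exists (maxn a b) => T c A; rewrite geq_max =>
      /andP[/subset_of_card[S1 sS1 cS1] /subset_of_card[S2 sS2 cS2]].
  case E: (c set0); [left; exists S1 | right; exists S2]; split=> // e _ /eqP;
      rewrite cards_eq0 => /eqP->; exact: E.
have triv T (c : {set T} -> bool) (A : {set T}) d : exists S : {set T}, [/\ S \subset A,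
    #|S| = 0 & mono c d k.+1 S].
  exists set0; split; rewrite ?sub0set ?cards0 // => e; rewrite subset0 => /eqP->;
      by rewrite cards0.
have [n] := ubnP (a + b); elim: n a b => // n IHn [|a] [|b] lt;
  try by exists 0 => T c A _; (left + right); apply: triv.
have [N1 HN1] := IHn a b.+1 ltac:(lia).
have [N2 HN2] := IHn a.+1 b ltac:(lia).
have [N HN] := IHk N1 N2.
exists N.+1 => T c A leN.
have /card_gt0P[v vA] : 0 < #|A| by lia.
have card1 : N <= #|A :\ v| by move: leN; rewrite (cardsD1 v A) vA.
have ext d (B S : {set T}) : B \subset A :\ v -> mono (fun e => c (v |: e)) d k B ->
    S \subset B -> mono c d k.+1 S ->
    [/\ v |: S \subset A, #|v |: S| = #|S|.+1 & mono c d k.+1 (v |: S)].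
  move=> sB mB sS mS.
  have vS : v \notin S by apply/negP => /(subsetP sS)/(subsetP sB); rewrite !inE eqxx.
  split.
  - rewrite subUset sub1set vA; apply: subset_trans sS _; apply: subset_trans sB _;
      exact: subD1set.
  - by rewrite cardsU1 vS.
  - move=> e se ce; case ve: (v \in e).
      rewrite -(setD1K ve); apply: mB; last by move: ce; rewrite (cardsD1 v) ve => -[].
      by apply: subset_trans _ sS; rewrite subDset.
    apply: mS => //; apply/subsetP => x xe; move: (subsetP se x xe).
    by case/setU1P => // xv; move: ve; rewrite -xv xe.
case: (HN T (fun e => c (v |: e)) (A :\ v) card1) => -[B [sB cB mB]].
  case: (HN1 T c B); rewrite ?cB // => -[S [sS cS mS]].
    by left; exists (v |: S); case: (ext _ _ _ sB mB sS mS) => ? -> ?; rewrite cS.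
  right; exists S; split=> //; apply: subset_trans sS _; apply: subset_trans sB _;
      exact: subD1set.
case: (HN2 T c B); rewrite ?cB // => -[S [sS cS mS]].
  left; exists S; split=> //; apply: subset_trans sS _; apply: subset_trans sB _; exact: subD1set.
by right; exists (v |: S); case: (ext _ _ _ sB mB sS mS) => ? -> ?; rewrite cS.
Qed.

(* The Gallai-Milgram argument: two paths of a cover with adjacent last
   vertices can be merged by reversing one of them. *)
Lemma path_cover (T : eqType) (e : rel T) (s : seq T) r : symmetric e -> uniq s ->
  (forall u, uniq u -> {subset u <= s} -> pairwise (fun x y => ~~ e x y) u -> size u <= r) ->
  exists ss, [/\ perm_eq (flatten ss) s, all (sorted e) ss & size ss <= r].
Proof.
move=> sym us indep.
(* Start from one-vertex paths and merge two of them as long as more than [r] remain; [n] bounds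
   their number. *)
suff: forall n (ss : seq (seq T)), size ss <= n -> perm_eq (flatten ss) s ->
    all (sorted e) ss -> all (fun p => p != [::]) ss ->
  exists ss, [/\ perm_eq (flatten ss) s, all (sorted e) ss & size ss <= r].
  move=> /(_ _ [seq [:: x] | x <- s] (leqnn _)); apply.
  - by elim: (s) => //= x s' IH; rewrite perm_cons.
  - by apply/allP => p /mapP[x _ ->].
  - by apply/allP => p /mapP[x _ ->].
elim=> [|n IHn] ss sz perm srt ne.
  by exists ss; split=> //; apply: leq_trans sz _.
case: (leqP (size ss) r) => [?|big]; first by exists ss.
case E: ss => [|[|x0 p0] ss0]; [by rewrite E in big | by rewrite E in ne |].
pose lst p := last x0 p.
have uf : uniq (flatten ss) by rewrite (perm_uniq perm).
(* If no two last vertices are adjacent, they form an independent set with more than [r]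
   elements. *)
have [H|] := boolP (pairwise (fun p q : seq T => ~~ e (lst p) (lst q)) ss).
  have: size (map lst ss) <= r.
    have lstin p : p \in ss -> lst p \in p.
      by move/(allP ne); case: p => // y p _; rewrite /lst /=; apply: mem_last.
    apply: indep; last first.
    - by rewrite pairwise_map.
    - by move=> y /mapP[p pin ->]; rewrite -(perm_mem perm); apply/flattenP; exists p => //;
        exact: lstin.
    - clear -uf lstin; elim: ss uf lstin => //= p ss IH; rewrite cat_uniq =>
        /and3P[up /hasPn dis uf] lstin.
      rewrite IH // ?andbT => [|q qin]; last by apply: lstin; rewrite inE qin orbT.
      apply/negP => /mapP[q qin E]; have /dis /negP[] : lst q \in flatten ss.
        by apply/flattenP; exists q => //; apply: lstin; rewrite inE qin orbT.
      by rewrite -E /=; apply: lstin; rewrite inE eqxx.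
  by rewrite size_map leqNgt big.
have split_ss : forall ss : seq (seq T), ~~ pairwise (fun p q => ~~ e (lst p) (lst q)) ss ->
   exists p q ss', perm_eq ss [:: p, q & ss'] /\ e (lst p) (lst q).
  elim=> //= p l IH; rewrite negb_and => /orP[/allPn[q qin]|/IH[p' [q' [l' [pm ee]]]]].
    rewrite negbK => ee; exists p, q, (rem q l); split=> //; rewrite perm_cons;
        exact: perm_to_rem.
  exists p', q', (p :: l'); split=> //.
  apply: (@perm_trans _ (p :: [:: p', q' & l'])); first by rewrite perm_cons.
  exact/permPl/(perm_catCA [:: p] [:: p'; q'] l').
case/split_ss => p [q [ss' [pm ee]]].
have := perm_all (sorted e) pm; rewrite srt /= => /esym /and3P[sp sq sss].
have := perm_all (fun p => p != [::]) pm; rewrite ne /= => /esym /and3P[np nq nss].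
apply: (IHn ((p ++ rev q) :: ss')).
- by move: sz; rewrite (perm_size pm).
- apply: perm_trans perm; rewrite perm_sym; apply: perm_trans (perm_flatten pm) _.
  by rewrite /= -catA perm_cat2l perm_cat2r perm_sym perm_rev.
- rewrite /= sss andbT; case: p np sp ee {pm} => // x p _ sp ee.
  case/lastP: q nq sq ee => // q y _ sq; rewrite /lst /= last_rcons => ee.
  rewrite rev_rcons /= cat_path /=; move: sp => /= ->; rewrite ee /=.
  have: sorted e (rev (rcons q y)).
    by rewrite rev_sorted; move: sq; apply: sub_sorted => a b; rewrite sym.
  by rewrite rev_rcons.
- by rewrite /= nss andbT; case: (p) np.
Qed.

Lemma pairwise_sym_in (T : eqType) (e : rel T) u : symmetric e -> pairwise e u ->
  {in u &, forall x y, x != y -> e x y}.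
Proof.
move=> sym; elim: u => // a u IH /= /andP[/allP ha pu] x y.
rewrite !inE => /predU1P[->|xu] /predU1P[->|yu] //; last exact: IH.
- by rewrite eqxx.
- by move=> _; apply: ha.
- by move=> _; rewrite sym; apply: ha.
Qed.

Lemma flatten_long (T : eqType) (ss : seq (seq T)) k r :
  size ss <= r -> r * k < size (flatten ss) -> exists2 p, p \in ss & k < size p.
Proof.
elim: ss r => [|p ss IH] [|r] //= le; rewrite size_cat => lt.
have [h|h] := ltnP k (size p); first by exists p; rewrite ?mem_head.
by have [|q qs hq] := IH r le; [lia | exists q; rewrite // inE qs orbT].
Qed.

Lemma flatten_uniq_mem (T : eqType) (ss : seq (seq T)) p : uniq (flatten ss) -> p \in ss ->
    uniq p.
Proof.
elim: ss => //= q ss IH; rewrite cat_uniq inE => /and3P[uq _ us] /predU1P[->//|]; exact: IH.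
Qed.

Lemma long_path (T : eqType) (e : rel T) (s : seq T) r k : symmetric e -> uniq s ->
  (forall u, uniq u -> {subset u <= s} -> {in u &, forall x y, x != y -> ~~ e x y} ->
      size u <= r) ->
  r * k < size s ->
  exists p, [/\ uniq p, {subset p <= s}, sorted e p & k < size p].
Proof.
move=> sym us indep lt.
have [|ss [pm srt szss]] := path_cover (r := r) sym us.
  move=> u uu ul pu; apply: indep => //; apply: pairwise_sym_in pu.
  by move=> x y; rewrite sym.
have [|p pss szp] := flatten_long (k := k) szss; first by rewrite (perm_size pm).
exists p; split=> //; last exact: (allP srt).
- by apply: flatten_uniq_mem pss; rewrite (perm_uniq pm).
- by move=> z zp; rewrite -(perm_mem pm); apply/flattenP; exists p.
Qed.

(** * Links between red cliques *)

Lemma set3_rev (T : finType) (x y z : T) : [set x; y; z] = [set z; y; x].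
Proof. by apply/setP => u; rewrite !inE; do 3! case: eqP. Qed.

Lemma set3_rot (T : finType) (x y z : T) : [set x; y; z] = [set y; z; x].
Proof. by apply/setP => u; rewrite !inE; do 3! case: eqP. Qed.

Lemma card_set3 (T : finType) (x y z : T) : uniq [:: x; y; z] -> #|[set x; y; z]| = 3.
Proof.
rewrite /= !inE negb_or => /and3P[/andP[xy xz] yz _].
by rewrite -setUA !cardsU1 cards1 !inE negb_or xy xz yz.
Qed.

(** Fix [2s] elements of [Y]. By pigeonhole, many elements of [X] have the same values of [phi] on
    all of them, and one value occurs there at least [s] times. *)
Lemma biclique_sets s : exists t, forall (T : finType) (phi : rel T) (X Y : {set T}),
  t <= #|X| -> t <= #|Y| ->
  exists b (S S' : {set T}), [/\ S \subset X, S' \subset Y, s <= #|S|, s <= #|S'| &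
    forall x y, x \in S -> y \in S' -> phi x y = b].
Proof.
exists (2 ^ (s + s) * s + s + s).+1 => T phi X Y hX hY.
have [Y0 sY0 cY0] : exists2 Y0 : {set T}, Y0 \subset Y & #|Y0| = s + s.
  apply: subset_of_card; lia.
have [||k kY big] := @pigeonhole_set _ _ (fun x => [set y in Y0 | phi x y]) X (powerset Y0) s.
- by move=> x _; rewrite inE; apply/subsetP => y; rewrite inE => /andP[].
- by rewrite card_powerset cY0; lia.
have eqk x y : x \in X -> [set y in Y0 | phi x y] == k -> y \in Y0 -> phi x y = (y \in k).
  by move=> _ /eqP<- yY; rewrite inE yY.
have := cardsID k Y0; rewrite cY0 => cc.
have [h|h] := leqP s #|Y0 :&: k|.
  exists true, [set x in X | [set y in Y0 | phi x y] == k], (Y0 :&: k); split=> //.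
  - by apply/subsetP => x; rewrite inE => /andP[].
  - by apply: subset_trans _ sY0; apply: subsetIl.
  - exact: ltnW.
  - by move=> x y; rewrite !inE => /andP[xX xk] /andP[yY yk]; rewrite eqk // yY.
exists false, [set x in X | [set y in Y0 | phi x y] == k], (Y0 :\: k); split=> //.
- by apply/subsetP => x; rewrite inE => /andP[].
- by apply: subset_trans _ sY0; apply: subsetDl.
- exact: ltnW.
- lia.
- by move=> x y; rewrite !inE => /andP[xX xk] /andP[yk yY]; rewrite eqk // (negbTE yk).
Qed.

Definition blue_arc (T : finType) (c : {set T} -> bool) (X Y : {set T}) :=
  forall x y z, x \in X -> y \in X -> x != y -> z \in Y -> c [set x; y; z] = false.

Lemma blue_arcS (T : finType) (c : {set T} -> bool) (X Y X' Y' : {set T}) :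
  X' \subset X -> Y' \subset Y -> blue_arc c X Y -> blue_arc c X' Y'.
Proof. by move=> /subsetP sX /subsetP sY h x y z /sX ? /sX ? ? /sY ?; apply: h. Qed.

(* The pairs [{a, b}] and [{x, y}] can be joined by the red tight path [a b x y].
   Asking for such a path off every pair [F] leaves room, when the path runs through
   a third set, for the vertices by which it entered [X]. *)
Definition linked (T : finType) (c : {set T} -> bool) : rel {set T} := fun X Y =>
  [forall F : {set T}, (#|F| <= 2) ==>
    [exists a in X :\: F, exists b in X :\: F, exists x in Y :\: F, exists y in Y :\: F,
      [&& a != b, x != y, c [set a; b; x] & c [set b; x; y]]]].

Lemma linkedP (T : finType) (c : {set T} -> bool) (X Y : {set T}) :
  reflect (forall F : {set T}, #|F| <= 2 ->
    exists a b x y, [/\ [/\ a \in X :\: F, b \in X :\: F, x \in Y :\: F & y \in Y :\: F],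
      a != b, x != y, c [set a; b; x] & c [set b; x; y]]) (linked c X Y).
Proof.
apply: (iffP forallP) => h F.
  move=> le; have := h F; rewrite le.
  case/exists_inP => a aX /exists_inP[b bX /exists_inP[x xY /exists_inP[y yY /and4P[? ? ? ?]]]].
  by exists a, b, x, y.
apply/implyP => le; have [a [b [x [y [[? ? ? ?] ? ? ? ?]]]]] := h F le.
apply/exists_inP; exists a => //; apply/exists_inP; exists b => //.
by apply/exists_inP; exists x => //; apply/exists_inP; exists y => //; apply/and4P.
Qed.

Lemma linked_sym (T : finType) (c : {set T} -> bool) : symmetric (linked c).
Proof.
suff H X Y : linked c X Y -> linked c Y X by move=> X Y; apply/idP/idP; apply: H.
move/linkedP => h; apply/linkedP => F le.
have [a [b [x [y [[? ? ? ?] ? ? cabx cbxy]]]]] := h F le.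
exists y, x, b, a; split; rewrite ?(eq_sym y) ?(eq_sym b) //; last by rewrite set3_rev.
by rewrite set3_rev.
Qed.

Lemma linkedS (T : finType) (c : {set T} -> bool) (X Y X' Y' : {set T}) :
  X' \subset X -> Y' \subset Y -> linked c X' Y' -> linked c X Y.
Proof.
move=> sX sY /linkedP h; apply/linkedP => F /h[a [b [x [y [[? ? ? ?] ? ? ? ?]]]]].
by exists a, b, x, y; split=> //; split;
    by [apply: (subsetP (setSD F sX)) | apply: (subsetP (setSD F sY))].
Qed.

Lemma unlinked_blue_arc s : exists t, forall (T : finType) (c : {set T} -> bool) (X Y : {set T}),
  t <= #|X| -> t <= #|Y| -> ~~ linked c X Y ->
  exists S S' : {set T}, [/\ S \subset X, S' \subset Y, s <= #|S|, s <= #|S'| &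
    blue_arc c S S' \/ blue_arc c S' S].
Proof.
have [t ht] := biclique_sets s; exists (t + 2) => T c X Y hX hY.
case/forallPn => F; rewrite negb_imply => /andP[cF no].
have cD (Z : {set T}) : t + 2 <= #|Z| -> t <= #|Z :\: F|.
  have := cardsID F Z; have := subset_leq_card (subsetIr Z F); lia.
(* The relation says that some red triple [{x', x, y}] can open a linking path. If it always holds
   on [S], [S'], a red triple with one vertex in [S] and two in [S'] would complete a link, so these
   triples are blue. If it never holds, the triples with two vertices in [S] and one in [S'] are
   blue. *)
have [b [S [S' [sS sS' cS cS' hb]]]] := ht T
  (fun x y => [exists x' in X :\: F, (x' != x) && c [set x'; x; y]]) _ _ (cD _ hX) (cD _ hY).
exists S, S'; split=> //; try (apply: subset_trans; [eassumption | exact: subsetDl]).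
case: b hb => hb; [right|left] => x y z xS yS xy zS.
  have /exists_inP[x' x'X /andP[ne red]] := hb z x zS xS.
  apply/negP => cb; case/negP: no.
  apply/exists_inP; exists x' => //; apply/exists_inP; exists z; first exact: (subsetP sS).
  apply/exists_inP; exists x; first exact: (subsetP sS').
  apply/exists_inP; exists y; first exact: (subsetP sS').
  by rewrite ne xy red -set3_rot set3_rot set3_rot cb.
apply/negP => cb; have /exists_inP[] := negbT (hb y z yS zS).
by exists x; rewrite ?xy // (subsetP sS).
Qed.

(** The pairs are treated one after the other. This is possible because subsets of unlinked sets are
    unlinked ([linkedS]) and blue arcs pass to subsets ([blue_arcS]). *)
Lemma unlinked_refine (I : finType) s (l : seq (I * I)) : exists t,
    forall (T : finType) (c : {set T} -> bool) (A : I -> {set T}),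
  (forall i, t <= #|A i|) ->
  (forall p, p \in l -> p.1 != p.2 /\ ~~ linked c (A p.1) (A p.2)) ->
  exists B : I -> {set T}, [/\ forall i, B i \subset A i, forall i, s <= #|B i| &
   forall p, p \in l -> blue_arc c (B p.1) (B p.2) \/ blue_arc c (B p.2) (B p.1)].
Proof.
elim: l => [|p l [t' IH]]; first by exists s => T c A hA _; exists A.
have [t ht] := unlinked_blue_arc t'; exists (maxn t t') => T c A hA hl.
have [ne nl] := hl p (mem_head _ _).
have [||S [S' [sS sS' cS cS' blue]]] := ht T c (A p.1) (A p.2) _ _ nl.
- exact: leq_trans (leq_maxl _ _) (hA _).
- exact: leq_trans (leq_maxl _ _) (hA _).
pose A' i := if i == p.1 then S else if i == p.2 then S' else A i.
have sA' i : A' i \subset A i by rewrite /A'; case: eqP => [->//|_]; case: eqP => [->//|_].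
have [||B [sB cB hB]] := IH T c A'.
- by rewrite /A' => i; do 2! case: ifP => //; rewrite (leq_trans (leq_maxr _ _) (hA _)).
- move=> q ql; have [|? /negP nq] := hl q; first by rewrite inE ql orbT.
  by split=> //; apply/negP => h; apply: nq; exact: linkedS (sA' _) (sA' _) h.
exists B; split=> // [i|q]; first exact: subset_trans (sB i) (sA' i).
rewrite inE => /orP[/eqP->|/hB //].
have := sB p.1; have := sB p.2; rewrite /A' !eqxx eq_sym (negbTE ne) => s2 s1.
by case: blue => h; [left|right]; apply: blue_arcS h.
Qed.

(* A blue copy of [H(TT_k, m)] in [V] with classes [A 0, ..., A (k - 1)]; [A i] is junk for
   [i >= k]. *)
Definition blueH (T : finType) (c : {set T} -> bool) k m (V : {set T}) :=
  exists A : nat -> {set T}, [/\ forall i, i < k -> A i \subset V /\ m <= #|A i|,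
    forall i j, i < j < k -> [disjoint A i & A j] &
    forall i j, i < j < k -> blue_arc c (A i) (A j)].

(** The property that [tourn_ramsey k] minimises. *)
Definition forces_TT k N := forall M, N <= M -> forall T : rel 'I_M, is_tournament T ->
    contains_TT T k.

(** After refinement the blue arcs contain a tournament on the [R] sets, and a transitive
    subtournament selects the classes. *)
Lemma unlinked_blueH k m R : forces_TT k R -> exists t, forall (T : finType) (c : {set T} ->
    bool) (A : 'I_R -> {set T}) (V : {set T}),
  (forall i, A i \subset V) -> (forall i, t <= #|A i|) ->
  (forall i j, i != j -> [disjoint A i & A j]) -> (forall i j, i != j ->
      ~~ linked c (A i) (A j)) ->
  blueH c k m V.
Proof.
move=> forc; have [t ht] := unlinked_refine m [seq p <- enum {: 'I_R * 'I_R} | p.1 != p.2].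
exists t => T c A V sV hA dis unl.
have [//||B [sB cB hB]] := ht T c A.
  by move=> p; rewrite mem_filter => /andP[ne _]; split=> //; apply: unl.
have {hB} hB i j : i != j -> blue_arc c (B i) (B j) \/ blue_arc c (B j) (B i).
  by move=> ne; apply: (hB (i, j)); rewrite mem_filter ne mem_enum.
have [D hD] : exists D : rel 'I_R, forall i j, D i j <-> blue_arc c (B i) (B j).
  exists (fun i j => if ClassicalEpsilon.excluded_middle_informative (blue_arc c (B i) (B j))
      then true else false).
  by move=> i j; case: ClassicalEpsilon.excluded_middle_informative.
(* If both directions are blue arcs, the one from the smaller index is taken, so that [E] is a
   tournament. *)
pose E : rel 'I_R := fun i j => if i < j then D i j else (j < i) && ~~ D j i.
have hE i j : E i j -> blue_arc c (B i) (B j).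
  rewrite /E; case: ltnP => [_ /hD //|_ /andP[lt /negP nD]].
  have [|/hD //|//] := hB j i; by rewrite neq_ltn lt.
have [|f [injf hf]] := forc R (leqnn _) E.
  split=> [i|i j]; rewrite /E ?ltnn //.
  by rewrite neq_ltn => /orP[] lt; rewrite lt ltnNge (ltnW lt) /=; case: (D _ _).
exists (fun i => if insub i is Some j then B (f j) else set0); split=> [i lt|i j|i j].
- by rewrite insubT; split=> //; apply: subset_trans (sV _).
- case/andP => ij jk; rewrite !insubT ?(ltn_trans ij) //= => ik.
  apply: (disjointWl (sB _)); apply: (disjointWr (sB _)); apply: dis.
  by rewrite (inj_eq injf) -val_eqE /= neq_ltn ij.
- case/andP => ij jk; rewrite !insubT ?(ltn_trans ij) //= => ik.
  by apply: hE; apply: hf.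
Qed.

(** * Tight paths through chains of red cliques *)

Fixpoint tight (T : finType) (c : {set T} -> bool) (s : seq T) : bool :=
  if s is x :: s' then (if s' is y :: z :: _ then c [set x; y; z] else true) &&
      tight c s' else true.

Definition redpath (T : finType) (c : {set T} -> bool) n (V : {set T}) :=
  exists s : seq T, [/\ uniq s, n <= size s, {subset s <= V} & tight c s].

(** The pieces overlap in the pair [a], [b], so every consecutive triple lies within one of them. *)
Lemma tight_glue (T : finType) (c : {set T} -> bool) (p : seq T) a b q :
  tight c (p ++ [:: a; b]) -> tight c [:: a, b & q] -> tight c (p ++ [:: a, b & q]).
Proof.
elim: p => // x p IH /= /andP[h1 /IH h2] /h2 ->; rewrite andbT.
by case: p {IH h2} h1 => [|y [|z p]].
Qed.

Lemma red_triple (T : finType) (c : {set T} -> bool) (Q : {set T}) x y z :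
  mono c true 3 Q -> x \in Q -> y \in Q -> z \in Q -> uniq [:: x; y; z] -> c [set x; y; z].
Proof. by move=> h xQ yQ zQ u; apply: h (card_set3 u); rewrite !subUset !sub1set xQ yQ. Qed.

(** A tight path starting with two vertices of a red clique [Q] stays red when new vertices of [Q]
    are put in front; this invariant lets paths grow at the front. *)
Definition heads (T : finType) (Q : {set T}) (s : seq T) :=
    if s is y :: z :: _ then (y \in Q) && (z \in Q) else false.

Lemma tight_clique_cat (T : finType) (c : {set T} -> bool) (Q : {set T}) v s :
  mono c true 3 Q -> {subset v <= Q} -> heads Q s -> uniq (v ++ s) -> tight c s ->
  heads Q (v ++ s) && tight c (v ++ s).
Proof.
move=> mQ; elim: v => [|x v IH] sv hs /=; first by move=> _ ->; rewrite hs.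
case/andP=> xv uv ts; have xQ : x \in Q by apply: sv; rewrite mem_head.
have /andP[] : heads Q (v ++ s) && tight c (v ++ s).
  by apply: IH => // z zv; apply: sv; rewrite inE zv orbT.
case: (v ++ s) uv xv => // y [|z s'] //= uv xv /andP[yQ zQ] /andP[-> ->].
rewrite xQ yQ !andbT /=; apply: red_triple mQ _ _ _ _ => //=.
move: xv uv; rewrite !inE !negb_or andbT => /and3P[-> -> _] /andP[/andP[-> _] _] //.
Qed.

Lemma card_big_has (T : finType) t (l : seq {set T}) : (forall X, X \in l -> #|X| = t) ->
  #|[set z | has (fun X : {set T} => z \in X) l]| <= t * size l.
Proof.
elim: l => [|X l IH] h /=; first by rewrite muln0 leqn0 cards_eq0; apply/eqP/setP => z;
    rewrite !inE.
rewrite mulnS; have <- : #|X| = t by apply: h; rewrite mem_head.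
have -> : [set z | (z \in X) || has (fun Y : {set T} =>
    z \in Y) l] = X :|: [set z | has (fun Y : {set T} => z \in Y) l].
  by apply/setP => z; rewrite !inE.
rewrite cardsU; apply: leq_trans (leq_subr _ _) _; rewrite leq_add2l.
have -> : #|X| = t by apply: h; rewrite mem_head.
by apply: IH => Y Yl; apply: h; rewrite inE Yl orbT.
Qed.

Lemma card_ge2P (T : finType) (A : {set T}) : 2 <= #|A| -> exists a b, [/\ a \in A,
    b \in A & a != b].
Proof.
case/subset_of_card => S sS /eqP/cards2P[a [b [ne E]]]; exists a, b.
by split=> //; apply: (subsetP sS); rewrite E !inE eqxx ?orbT.
Qed.

(* [U] collects the vertices already used or reserved for later cliques. *)
Definition fillable (T : finType) (c : {set T} -> bool) (V Q : {set T}) B ell :=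
  forall (a b x y : T) (U : {set T}), uniq [:: x; y; a; b] -> {subset [:: x; y; a; b] <= Q} ->
    Q \subset U -> #|U| <= B ->
    exists w : seq T, [/\ uniq ([:: x, y & w] ++ [:: a; b]), {subset w <= Q :|: (V :\: U)},
      tight c ([:: x, y & w] ++ [:: a; b]) & size w + 4 = ell].

Definition clique_family (T : finType) (c : {set T} -> bool) (V : {set T}) t (l : seq {set T}) :=
  [/\ uniq l, forall X, X \in l -> [/\ mono c true 3 X, #|X| = t & X \subset V] &
   forall X Y, X \in l -> Y \in l -> X != Y -> [disjoint X & Y]].

Lemma clique_family_sub (T : finType) (c : {set T} -> bool) (V : {set T}) t (l l' : seq {set T}) :
  uniq l' -> {subset l' <= l} -> clique_family c V t l -> clique_family c V t l'.
Proof.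
move=> u s [_ h d]; split=> // [X /s/h //|X Y /s Xl /s Yl]; exact: d.
Qed.

(** Passage through one clique of the chain, from the entry pair [x], [y] to the exit pair [a], [b],
    with a gain of [ell] vertices. *)
Lemma tight_extend (T : finType) (c : {set T} ->
    bool) (V : {set T}) t B ell Q Qs (p : seq T) (x y a b : T) :
  clique_family c V t (Q :: Qs) -> fillable c V Q B ell ->
  uniq (p ++ [:: x; y]) -> uniq [:: x; y; a; b] -> {subset [:: x; y; a; b] <= Q} ->
      {subset p <= V} ->
  (forall X z, X \in Q :: Qs -> z \in p -> z \notin X) -> tight c (p ++ [:: x; y]) ->
  size p + t * (size Qs).+1 <= B ->
  exists p' : seq T, [/\ uniq (p' ++ [:: a; b]), {subset p' ++ [:: a; b] <= V},
    forall X z, X \in Qs -> z \in p' ++ [:: a; b] -> z \notin X,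
    tight c (p' ++ [:: a; b]) & size p' + 2 = size p + ell].
Proof.
move=> [/= /andP[QnQs uQs] hfam dis] fill up u4 sQ pV pdis tp szB.
have [mQ cQ QV] := hfam Q (mem_head _ _).
(* Avoiding [p] keeps the vertices distinct; reserving the later cliques keeps them intact for the
   rest of the path. *)
pose U := [set z in p] :|: [set z | has (fun X : {set T} => z \in X) (Q :: Qs)].
have cU : #|U| <= B.
  rewrite cardsU cardsE; apply: leq_trans (leq_subr _ _) _.
  apply: leq_trans _ szB; apply: leq_add; first exact: card_size.
  by apply: (card_big_has (t := t)) => X /hfam[].
have QU : Q \subset U by apply/subsetP => z zQ; rewrite !inE /= zQ orbT.
have [w [uw sw tw szw]] := fill a b x y U u4 sQ QU cU.
have inw z : z \in [:: x, y & w] ++ [:: a; b] -> (z \in Q) || (z \in V :\: U).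
  rewrite -[x :: y :: w]/([:: x; y] ++ w) -catA !mem_cat => /or3P[zxy|/sw|zab].
  - by rewrite sQ // -[[:: x; y; a; b]]/([:: x; y] ++ [:: a; b]) mem_cat zxy.
  - by rewrite inE.
  - by rewrite sQ // -[[:: x; y; a; b]]/([:: x; y] ++ [:: a; b]) mem_cat zab orbT.
exists (p ++ [:: x, y & w]); rewrite -catA; split.
- rewrite cat_uniq uw andbT; move: up; rewrite cat_uniq => /and3P[-> _ _]; rewrite andTb.
  apply/hasPn => z /inw /orP[zQ|]; first by apply/negP => /(pdis Q _ (mem_head _ _)); rewrite zQ.
  by rewrite !inE !negb_or => /andP[/andP[]].
- move=> z; rewrite mem_cat => /orP[/pV //|/inw /orP[/(subsetP QV)//|]].
  by rewrite inE => /andP[].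
- move=> X z Xin; have Xin' : X \in Q :: Qs by rewrite inE Xin orbT.
  rewrite mem_cat => /orP[zp|/inw /orP[zQ|]]; first exact: pdis zp.
    rewrite (disjointFr _ zQ) // dis ?mem_head //.
    by apply: contraNneq QnQs => ->.
  rewrite inE => /andP[+ _]; apply: contraNN => zX.
  by rewrite !inE; apply/orP; right; apply/hasP; exists X.
- exact: tight_glue.
- by rewrite size_cat /= -szw; clear; lia.
Qed.

(** Induction along the chain: a link off the entry pair [{x, y}] supplies the exit pair of [Q] and
    the entry pair of the next clique. In the last clique any two other vertices serve as exit
    pair. *)
Lemma chain_tight (T : finType) (c : {set T} ->
    bool) (V : {set T}) t B ell Q Qs (p : seq T) (x y : T) :
  4 <= t <= ell -> clique_family c V t (Q :: Qs) -> path (linked c) Q Qs ->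
  (forall X, X \in Q :: Qs -> fillable c V X B ell) ->
  uniq (p ++ [:: x; y]) -> x \in Q -> y \in Q -> {subset p <= V} ->
  (forall X z, X \in Q :: Qs -> z \in p -> z \notin X) -> tight c (p ++ [:: x; y]) ->
  size p + ell * (size Qs).+1 <= B ->
  redpath c (size p + ell * (size Qs).+1) V.
Proof.
move=> /andP[t4 tell]; elim: Qs Q p x y =>
    [|Q' Qs IH] Q p x y fam pth fill up xQ yQ pV pdis tp szB;
  have nxy : x != y by [move: up; rewrite cat_uniq /= inE => /and3P[_ _ /andP[]]];
  have u4 a b : a \in Q :\: [set x; y] -> b \in Q :\: [set x; y] -> a != b ->
    uniq [:: x; y; a; b] /\ {subset [:: x; y; a; b] <= Q} by
  [ rewrite !inE !negb_or => /andP[/andP[ax ay] aQ] /andP[/andP[bx by_] bQ] ab; split;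
    [ by rewrite /= !inE !negb_or nxy ab (eq_sym x a) (eq_sym x b) (eq_sym y a) (eq_sym y b) ax
        ay bx by_
    | by move=> z; rewrite !inE => /or4P[] /eqP->] ].
  have [_ /(_ Q (mem_head _ _))[_ cQ _] _] := fam.
  have [a [b [/u4 h /h{h} h /h{h}[h1 h2]]]] : exists a b, [/\ a \in Q :\: [set x; y],
      b \in Q :\: [set x; y] & a != b].
    apply: card_ge2P; have := cardsID [set x; y] Q.
    have := subset_leq_card (subsetIr Q [set x; y]); rewrite cards2 nxy cQ; clear -t4; lia.
  have [|p' [? ? _ ? szp']] := tight_extend fam (fill Q (mem_head _ _)) up h1 h2 pV pdis tp;
      first by move: szB; rewrite /=; clear -tell; lia.
  by exists (p' ++ [:: a; b]); split=> //; rewrite size_cat /=; clear -szp'; lia.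
move: pth => /= /andP[/linkedP lnk pth].
have [|a [b [x' [y' [[aQ bQ xQ' yQ'] ab xy' cabx cbxy]]]]] := lnk [set x; y];
    first by rewrite cards2 nxy.
have [h1 h2] := u4 a b aQ bQ ab.
have [|p' [up' pV' pdis' tp' szp']] :=
    tight_extend fam (fill Q (mem_head _ _)) up h1 h2 pV pdis tp.
  apply: leq_trans szB; rewrite leq_add2l; exact: leq_mul.
have -> : size p + ell * (size (Q' :: Qs)).+1 = size (p' ++ [:: a; b]) + ell * (size Qs).+1.
  by rewrite size_cat /=; clear -szp'; lia.
move: xQ' yQ'; rewrite !inE => /andP[_ xQ'] /andP[_ yQ'].
apply: (IH Q' _ x' y') => //.
- have [/= /andP[_ uQs] _ _] := fam.
  apply: (@clique_family_sub _ _ _ _ _ (Q' :: Qs) uQs _ fam).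
  by move=> X Xin; rewrite inE Xin orbT.
- by move=> X Xin; apply: fill; rewrite inE Xin orbT.
- rewrite cat_uniq up' /= inE xy' /= orbF andbT; apply/norP; split; apply/negP => h.
    by have := pdis' Q' x' (mem_head _ _) h; rewrite xQ'.
  by have := pdis' Q' y' (mem_head _ _) h; rewrite yQ'.
- by rewrite -catA; apply: tight_glue => //=; rewrite cabx cbxy.
- by move: szB; rewrite size_cat /=; clear -szp'; lia.
Qed.

(** * Blue blow-ups and long chains of linked cliques *)

Lemma blueH_cons (T : finType) (c : {set T} -> bool) k m (V S W : {set T}) :
  S \subset V -> W \subset V -> m <= #|S| -> [disjoint S & W] -> blue_arc c S W ->
  blueH c k m W -> blueH c k.+1 m V.
Proof.
move=> sS sW cS dis arc [A [hA dA bA]].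
exists (fun i => if i is i'.+1 then A i' else S); split=>
    [[|i] //= lt|[|i] [|j] //= ij|[|i] [|j] //= ij].
- by have [sA ?] := hA i lt; split=> //; apply: subset_trans sW.
- by have [sA ?] := hA j ij; apply: disjointWr dis.
- exact: dA.
- by have [sA ?] := hA j ij; apply: blue_arcS arc.
- exact: bA.
Qed.

Lemma blueHS (T : finType) (c : {set T} -> bool) k m (V W : {set T}) :
  W \subset V -> blueH c k m W -> blueH c k m V.
Proof. by move=> s [A [hA dA bA]]; exists A; split=> // i /hA[sA ?]; split=> //;
    apply: subset_trans s. Qed.

Lemma mono_blueH (T : finType) (c : {set T} -> bool) k m (S : {set T}) :
  mono c false 3 S -> k * m <= #|S| -> blueH c k m S.
Proof.
elim: k S => [|k IH] S mS cS; first by exists (fun=> set0); split=> // i j; rewrite ltn0 andbF.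
have [S0 sS0 cS0] : exists2 S0 : {set T}, S0 \subset S & #|S0| = m.
  by apply: subset_of_card; apply: leq_trans cS; rewrite mulSn leq_addr.
apply: (blueH_cons (S := S0) (W := S :\: S0)) => //.
- exact: subsetDl.
- by rewrite cS0.
- by rewrite disjoints_subset setCD subsetUr.
- move=> x y z xS yS xy; rewrite inE => /andP[zS0 zS].
  apply: mS; last first.
    apply: card_set3; rewrite /= !inE !negb_or xy andbT /=.
    by apply/andP; split; apply: contraNneq zS0 => <-.
  by rewrite !subUset !sub1set zS !(subsetP sS0).
- apply: IH; first by move=> e se; apply: mS; apply: subset_trans se (subsetDl _ _).
  have := cardsID S0 S; have := subset_leq_card (subsetIr S S0); lia.
Qed.

(** Red cliques are removed greedily until fewer than [N] vertices are left. *)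
Lemma clique_family_cover (T : finType) (c : {set T} -> bool) t N (V : {set T}) : 0 < t ->
  (forall A : {set T}, A \subset V -> N <= #|A| -> exists S : {set T}, [/\ S \subset A,
      #|S| = t & mono c true 3 S]) ->
  exists2 l, clique_family c V t l & #|V| < N + t * size l.
Proof.
move=> t0; have [n] := ubnP #|V|; elim: n V => // n IH V lt h.
have [small|big] := ltnP #|V| N; first by exists [::]; [split | rewrite muln0 addn0].
have [S [sS cS mS]] := h V (subxx _) big.
have cD : #|V :\: S| = #|V| - t by rewrite cardsD (setIidPr sS) cS.
have le := subset_leq_card sS.
have [||l [ul hl dl] szl] := IH (V :\: S).
- lia.
- by move=> A sA; apply: h; apply: subset_trans sA (subsetDl _ _).
have disS X : X \in l -> [disjoint S & X].
  case/hl => _ _ sX; apply: disjointWr sX _; by rewrite disjoints_subset setCD subsetUr.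
exists (S :: l); last by rewrite /= mulnS; lia.
split=> /= [|X|X Y].
- rewrite ul andbT; apply/negP => /disS; rewrite -setI_eq0 setIid -cards_eq0; lia.
- rewrite inE => /orP[/eqP -> //|/hl[mX cX sX]]; split=> //;
    exact: subset_trans sX (subsetDl _ _).
- rewrite !inE => /orP[/eqP->|Xl] /orP[/eqP->|Yl]; rewrite ?eqxx // => ne.
  + exact: disS.
  + by rewrite disjoint_sym disS.
  + exact: dl.
Qed.

(** Since [r.+1] pairwise unlinked cliques would give a blue copy, [r] chains cover all cliques and
    one has more than [kappa] of them. The bound [t0] comes before [t] because [t] is later chosen
    in terms of [t0]. *)
Lemma linked_chain k m r : 0 < m -> forces_TT k r.+1 -> exists t0, forall t, t0 <= t -> 0 < t ->
  exists L, forall (T : finType) (c : {set T} -> bool) (V : {set T}) kappa,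
  L + t * (r * kappa) <= #|V| -> blueH c k m V \/
  exists Q Qs, [/\ clique_family c V t (Q :: Qs), path (linked c) Q Qs & size Qs = kappa].
Proof.
move=> m0 forc; have [t0 ht0] := unlinked_blueH m forc.
(* Any [L] vertices contain a red clique of size [t] or a blue one of size [k * m], which includes a
   blue copy. *)
exists t0 => t tt0 tpos; have [L hL] := ramsey_sets 3 t (k * m).
exists L => T c V kappa big.
case: (classic (blueH c k m V)) => [|nblue]; [by left | right].
have [|l [ul hl dl] szl] := @clique_family_cover T c t L V tpos.
  move=> A sA /hL h; case: (h c) => // -[S [sS cS mS]]; case: nblue.
  by apply: (@blueHS _ _ _ _ _ S); [apply: subset_trans sA | apply: mono_blueH; rewrite ?cS].
have lt : r * kappa < size l by nia.
have [u uu ul' ind|//|[|Q Qs] [//= /andP[QQs uQs] sl sp szp]] :=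
    @long_path _ (linked c) l r kappa (@linked_sym _ c) ul.
  rewrite leqNgt; apply/negP => ru.
  have lt_u (i : 'I_r.+1) : i < size u by apply: leq_trans ru; rewrite ltn_ord.
  have inl (i : 'I_r.+1) : nth set0 u i \in l by apply/ul'/mem_nth/lt_u.
  have ne (i i' : 'I_r.+1) : i != i' -> nth set0 u i != nth set0 u i' by rewrite nth_uniq.
  apply: nblue; apply: (ht0 T c (fun i => nth set0 u i) V).
  - by move=> i; have [] := hl _ (inl i).
  - by move=> i; have [_ ->] := hl _ (inl i).
  - by move=> i i' ii'; apply: dl; rewrite ?ne.
  - by move=> i i' ii'; apply: ind; rewrite ?mem_nth ?ne.
exists Q, (take kappa Qs); split.
- apply: clique_family_sub; last by split; [exact: ul | exact: hl | exact: dl].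
    rewrite /= take_uniq // andbT; apply: contra QQs; exact: mem_take.
  move=> X XQ; apply: sl; move: XQ; rewrite !inE => /orP[->//|/mem_take ->]; by rewrite orbT.
- exact: take_path.
- by rewrite size_takel.
Qed.

(** All of [Q] is visited, in any order, and nothing outside it. *)
Lemma fillable_clique (T : finType) (c : {set T} -> bool) (V Q : {set T}) B :
  mono c true 3 Q -> fillable c V Q B #|Q|.
Proof.
move=> mQ a b x y U u4 s4 _ _.
pose F := [set z in [:: x; y; a; b]]; exists (enum (Q :\: F)).
have FQ : F \subset Q by apply/subsetP => z; rewrite inE => /s4.
have cF : #|F| = 4 by rewrite cardsE; apply/card_uniqP.
have pm : perm_eq ([:: x, y & enum (Q :\: F)] ++ [:: a; b]) ([:: x; y; a; b] ++ enum (Q :\: F)).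
  by rewrite -[x :: y :: enum _]/([:: x; y] ++ enum _) -catA -[[:: x; y; a; b]]/([:: x;
      y] ++ [:: a; b]) -catA perm_cat2l perm_catC.
have uall : uniq ([:: x, y & enum (Q :\: F)] ++ [:: a; b]).
  rewrite (perm_uniq pm) cat_uniq u4 enum_uniq andbT /=; apply/hasPn => z.
  by rewrite mem_enum inE => /andP[]; rewrite inE.
split=> //.
- by move=> z; rewrite mem_enum !inE => /andP[_ ->].
- suff /andP[] : heads Q ([:: x, y & enum (Q :\: F)] ++ [:: a; b]) && tight c ([:: x,
    y & enum (Q :\: F)] ++ [:: a; b]) by [].
  apply: tight_clique_cat mQ _ _ uall _ => //.
  + move=> z; rewrite !inE mem_enum inE => /or3P[/eqP->|/eqP->|/andP[]//]; apply: s4;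
      rewrite !inE eqxx ?orbT //.
  + by rewrite /= !s4 // !inE eqxx ?orbT.
- by rewrite -cardE cardsD (setIidPr FQ) cF subnK // -cF subset_leq_card.
Qed.

(** * Weaving outside vertices into a red clique *)

Definition link_rel (T : finType) (c : {set T} -> bool) x : rel T := fun y z => (y != z) &&
    c [set y; z; x].

Lemma link_rel_sym (T : finType) (c : {set T} -> bool) x : symmetric (link_rel c x).
Proof. by move=> y z; rewrite /link_rel eq_sym [[set y; z]]setUC. Qed.

Definition link_path (T : finType) (c : {set T} -> bool) n (R : {set T}) x :=
  [exists v : n.-tuple T, [&& uniq v, all (mem R) v & sorted (link_rel c x) v]].

(* The path obtained is [v1 v2 x1 v3 v4 x2 v5 v6 ...]: one vertex outside [Q] for every two
   vertices of [Q]. *)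
Lemma weave_tight (T : finType) (c : {set T} -> bool) (Q : {set T}) (e : rel T) (xs v s : seq T) :
  mono c true 3 Q -> {subset v <= Q} -> sorted e v -> size v = (size xs).+1.*2 ->
  (forall x y z, x \in xs -> y \in Q -> z \in Q -> e y z -> c [set y; z; x]) ->
  heads Q s -> tight c s -> uniq (v ++ s) ->
  exists w, [/\ perm_eq w (v ++ xs), take 2 w = take 2 v & tight c (w ++ s)].
Proof.
move=> mQ; elim: xs v => [|x xs IH] [|a [|b v]] //= sv pv szv hx hs ts us.
  exists [:: a, b & v]; rewrite cats0; split=> //.
  by have /andP[] := tight_clique_cat mQ sv hs us ts.
case: v sv pv szv us => [|a' [|b' v]] // sv /= /and3P[eab eba /andP[eab' pv]] szv us.
have [|||||||w [pm tk tw]] := IH [:: a', b' & v].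
- by move=> z zv; apply: sv; rewrite !inE in zv *; rewrite zv !orbT.
- by rewrite /= eab' pv.
- by move: szv => /=; clear; lia.
- by move=> x' y z xin; apply: hx; rewrite inE xin orbT.
- exact: hs.
- exact: ts.
- by move: us => /= /and3P[].
case: w tk pm tw => [|a2 [|b2 w]] //=; rewrite ?take0 => -[-> ->] pm tw.
exists [:: a, b, x, a', b' & w]; split=> //.
  apply/permP => p; have /permP/(_ p) := pm; rewrite /= !count_cat /=; clear; lia.
have inQ z : z \in [:: a; b; a'; b'] -> z \in Q.
  by move=> zin; apply: sv; move: zin; rewrite !inE => /or4P[] ->; rewrite ?orbT.
have hxx y z := hx x y z (mem_head _ _).
have [aQ bQ a'Q b'Q] : [/\ a \in Q, b \in Q, a' \in Q & b' \in Q] by split; apply: inQ;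
    rewrite !inE eqxx ?orbT.
(* The new triples are [a b x], [b x a'] and [x a' b']; without [x] each is a pair of consecutive
   vertices of [v]. That the woven rest starts with [a'], [b'] is the [take 2] invariant. *)
rewrite /= hxx //= tw andbT; apply/andP; split.
  by rewrite set3_rot set3_rev hxx.
by rewrite set3_rot hxx.
Qed.

(** A link path with [2K] vertices has [K] pairs and room for [K - 1] outside vertices between them,
    hence the length [3K - 1]. The path comes from the link of one vertex [x0]; by pigeonhole enough
    vertices share that link. *)
Lemma block_step (T : finType) (c : {set T} -> bool) K (Q R W : {set T}) (s : seq T) :
  0 < K -> mono c true 3 Q -> R \subset Q -> [disjoint Q & W] -> heads Q s -> tight c s ->
      uniq s ->
  (forall z, z \in s -> z \notin R :|: W) ->
  2 ^ (2 ^ #|Q|) * K < #|[set x in W | link_path c K.*2 R x]| ->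
  exists w : seq T, [/\ size w + 1 = 3 * K, {subset w <= R :|: W}, count (mem Q) w = K.*2,
     uniq (w ++ s) & heads Q (w ++ s) && tight c (w ++ s)].
Proof.
move=> K0 mQ RQ dQW hs ts us sdis.
(* [f x] records the link of [x] on [Q], one of at most [2 ^ (2 ^ #|Q|)] families. *)
pose f x := [set e in powerset Q | c (x |: e)].
rewrite -!card_powerset => /(pigeonhole_set (f := f)) [|L _ big].
  by move=> x _; rewrite inE; apply/subsetP => e; rewrite inE => /andP[].
set F := [set x in _ | _] in big.
have FW x : x \in F -> x \in W by rewrite !inE => /andP[/andP[]].
have /card_gt0P[x0 x0F] : 0 < #|F| by clear -big; lia.
have /existsP[v /and3P[uv /allP vR0 pv]] : link_path c K.*2 R x0 by move: x0F; rewrite !inE =>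
    /andP[/andP[]].
have vR z : z \in v -> z \in R by move/vR0.
pose xs := take K.-1 (enum F).
have szxs : size xs = K.-1 by rewrite size_takel // -cardE; clear -big; lia.
have xsF x : x \in xs -> x \in F by move/mem_take; rewrite mem_enum.
have xsW x : x \in xs -> x \in W by move/xsF/FW.
have vQ z : z \in v -> z \in Q by move/vR/(subsetP RQ).
have uvx : uniq (v ++ xs).
  rewrite cat_uniq uv take_uniq ?enum_uniq // andbT; apply/hasPn => x /xsW xW.
  by apply/negP => /vQ xQ; rewrite (disjointFr dQW xQ) in xW.
have uvxs : uniq ((v ++ xs) ++ s).
  rewrite cat_uniq uvx us andbT; apply/hasPn => z /sdis; apply: contra; rewrite mem_cat inE.
  by case/orP => [/vR ->//|/xsW ->]; rewrite orbT.
have [|||||w [pm tk tw]] := weave_tight (Q := Q) (e := link_rel c x0) (xs := xs) (v := v) (s :=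
    s) mQ vQ pv.
- by rewrite size_tuple szxs prednK.
- move=> x y z /xsF xF yQ zQ /andP[_ cx0].
  have E : f x = f x0 by move: xF x0F; rewrite !inE => /andP[_ /eqP->] /andP[_ /eqP->].
  have : [set y; z] \in f x0 by rewrite !inE subUset !sub1set yQ zQ [x0 |: _]setUC.
  by rewrite -E !inE => /andP[_]; rewrite [x |: _]setUC.
- exact: hs.
- exact: ts.
- move: uvxs; rewrite !cat_uniq => /and3P[/and3P[-> _ _] h ->]; rewrite andbT.
  by apply: contra h => /hasP[z zs zv]; apply/hasP; exists z => //; rewrite mem_cat zv.
exists w; split.
- by rewrite (perm_size pm) size_cat size_tuple szxs; clear -K0; lia.
- by move=> z; rewrite (perm_mem pm) mem_cat inE => /orP[/vR ->//|/xsW ->]; rewrite orbT.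
- rewrite (permP pm) count_cat [X in _ + X](_ : _ = 0) ?addn0.
    by rewrite -[RHS](size_tuple v); apply/eqP; rewrite -all_count; apply/allP => z /vQ.
  by apply/eqP; rewrite -leqn0 leqNgt -has_count; apply/hasPn => z /xsW zW;
      rewrite inE (disjointFl dQW zW).
- by rewrite (perm_uniq (perm_cat pm (perm_refl s))).
- rewrite tw andbT; case: w tk pm {tw} => [|a [|b w]] tk pm.
  + by have := size_takel (n0 := 2) (s := v); rewrite -tk size_tuple /=; clear -K0;
      case: K K0 => //= K _ /(_ isT).
  + by have := size_takel (n0 := 2) (s := v); rewrite -tk size_tuple /=; clear -K0;
      case: K K0 => //= K _ /(_ isT).
  + have inv z : z \in take 2 v -> z \in Q by move/mem_take/vQ.
    by rewrite /= !inv // -tk /= !inE eqxx ?orbT.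
Qed.

Lemma card_setI_count (T : finType) (Q : {set T}) (l : seq T) : #|Q :&: [set z in l]| <= count
    (mem Q) l.
Proof.
rewrite -size_filter; apply: leq_trans (card_size _); apply: subset_leq_card.
by apply/subsetP => z; rewrite !inE mem_filter.
Qed.

(* The obstruction to weaving outside vertices into a red clique [Q]: many vertices [W] none of
   which has a long red path in its link on a large part [R] of [Q]. *)
Definition stuck (T : finType) (c : {set T} -> bool) (V Q : {set T}) C t2 N :=
  exists R W : {set T}, [/\ [/\ R \subset Q, t2 <= #|R|, W \subset V & [disjoint Q & W]],
      N <= #|W| &
    forall x, x \in W -> ~~ link_path c C R x].

(** Up to [j] blocks are put in front of the exit pair, each made of fresh vertices. When a block
    cannot be formed, the free outside vertices without a long link path show that [Q] is stuck. The
    final [4] counts the entry and exit pairs. *)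
Lemma fillable_or_stuck (T : finType) (c : {set T} -> bool) (V Q : {set T}) K j t2 N B :
  0 < K -> mono c true 3 Q -> K.*2 * j + t2 + 4 <= #|Q| ->
  N + B + 3 * K * j + 2 ^ (2 ^ #|Q|) * K <= #|V| ->
  fillable c V Q B (j * (3 * K).-1 + 4) \/ stuck c V Q K.*2 t2 N.
Proof.
move=> K0 mQ cQ cV; case: (classic (stuck c V Q K.*2 t2 N)) => [|nst]; [by right | left].
move=> a b x y U u4 s4 QU cU.
have inQ : [/\ x \in Q, y \in Q, a \in Q & b \in Q] by split; apply: s4; rewrite !inE eqxx ?orbT.
have [xQ yQ aQ bQ] := inQ.
have uab : uniq [:: a; b] by move: u4 => /= /and3P[_ _].
suff H i : i <= j -> exists w : seq T, [/\ [/\ uniq (w ++ [:: a; b]), x \notin w & y \notin w],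
    {subset w <= Q :|: (V :\: U)}, heads Q (w ++ [:: a; b]) && tight c (w ++ [:: a; b]),
    size w = i * (3 * K).-1 & count (mem Q) w = K.*2 * i].
  have [w [[uw xw yw] sw /andP[hw tw] szw _]] := H j (leqnn j); exists w.
  have uall : uniq ([:: x; y] ++ (w ++ [:: a; b])).
    rewrite cat_uniq uw andbT; move: u4; rewrite /= !inE !negb_or => /and4P[/and3P[->
        xa xb] /andP[ya yb] _ _] /=.
    rewrite -all_predC all_cat /= !inE !negb_or ![_ == x]eq_sym ![_ == y]eq_sym xa xb ya yb
        !andbT.
    by apply/allP => z zw /=; rewrite !inE negb_or; apply/andP; split;
        [apply: contraNneq xw | apply: contraNneq yw] => <-.
  have : heads Q ([:: x; y] ++ (w ++ [:: a; b])) && tight c ([:: x; y] ++ (w ++ [:: a; b])).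
    by apply: tight_clique_cat => // z; rewrite !inE => /orP[] /eqP ->.
  case/andP => _ tall; split=> //; by rewrite szw.
elim: i => [|i IH] ij.
  by exists [::]; rewrite muln0; split=> //=; rewrite aQ bQ.
have [w [[uw xw yw] sw /andP[hw tw] szw cw]] := IH (ltnW ij).
(* [R] and [W] are the vertices still free inside and outside [Q]; the [i] blocks and the two pairs
   have used [2 K i + 4] vertices of [Q]. *)
pose R := Q :\: [set z in [:: x; y] ++ w ++ [:: a; b]].
pose W := (V :\: U) :\: [set z in w].
pose Gd := [set z in W | link_path c K.*2 R z].
have RQ : R \subset Q by apply: subsetDl.
have dQW : [disjoint Q & W].
  rewrite disjoints_subset; apply/subsetP => z zQ; rewrite !inE (subsetP QU z zQ) andbF //.
have cR : t2 <= #|R|.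
  rewrite cardsD; have := card_setI_count Q ([:: x; y] ++ w ++ [:: a; b]).
  rewrite !count_cat /= xQ yQ aQ bQ cw; move: cQ ij; clear.
  set u := #|_|; set v := #|_|; clearbody u v; nia.
have cW : N + 2 ^ (2 ^ #|Q|) * K <= #|W|.
  have h1 : #|[set z in w]| <= i * (3 * K).-1 by rewrite -szw cardsE card_size.
  have h2 : #|V| - #|U| <= #|V :\: U| by rewrite cardsD leq_sub2l // subset_leq_card // subsetIr.
  have h3 : #|V :\: U| - #|[set z in w]| <= #|W| by rewrite [#|W|]cardsD leq_sub2l //
      subset_leq_card // subsetIr.
  have h4 : i * (3 * K).-1 <= 3 * K * j by rewrite mulnC leq_mul ?leq_pred // ltnW.
  move: cV cU h1 h2 h3 h4; clear; lia.
have [small|big] := leqP #|Gd| (2 ^ (2 ^ #|Q|) * K).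
  case: nst; exists R, (W :\: Gd); split; first split=> //.
  - by apply: subset_trans (subsetDl _ _) _; apply: subset_trans (subsetDl _ _) _;
      apply: subsetDl.
  - by apply: disjointWr dQW; apply: subsetDl.
  - have h : #|W| - #|Gd| <= #|W :\: Gd| by rewrite [#|W :\: Gd|]cardsD leq_sub2l //
      subset_leq_card // subsetIr.
    move: cW small h; clear; lia.
  - by move=> z; rewrite !inE negb_and => /andP[/orP[/negP h1|//] h2]; case: h1.
have [|w' [szw' sw' cw' uw' /andP[hw' tw']]] := block_step K0 mQ RQ dQW hw tw uw _ big.
  move=> z zw; rewrite !inE negb_or; apply/andP; split.
    by rewrite negb_and negbK; move: zw; rewrite !mem_cat !inE => ->; rewrite !orbT.
  move: zw; rewrite mem_cat => /orP[-> //|]; rewrite !inE => /orP[] /eqP ->;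
  by rewrite (subsetP QU) ?andbF // aQ.
exists (w' ++ w); split.
- have nR z : z \in Q -> z \notin R -> z \notin w'.
    by move=> zQ zR; apply/negP => /sw'; rewrite inE (negbTE zR) (disjointFr dQW).
  rewrite -catA uw' !mem_cat !negb_or xw yw !andbT; split=> //; apply: nR => //;
      by rewrite !inE eqxx ?orbT.
- move=> z; rewrite mem_cat => /orP[/sw'|/sw //].
  rewrite !inE => /orP[/andP[_ -> //]|/andP[_ ->]]; by rewrite orbT.
- by rewrite -catA hw' tw'.
- rewrite size_cat szw; move: szw' K0; clear; nia.
- rewrite count_cat cw cw'; clear; nia.
Qed.

(** Gallai-Milgram in the link graph of [x]: without [s] independent vertices, fewer than [s] paths
    cover [R], and one of them contains a path on [C] vertices. *)
Lemma link_indep (T : finType) (c : {set T} -> bool) (R : {set T}) x C s :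
  s * C <= #|R| -> ~~ link_path c C R x ->
  exists S : {set T}, [/\ S \subset R, s <= #|S| & forall y z, y \in S -> z \in S -> y != z ->
      c [set y; z; x] = false].
Proof.
move=> cR np; case: s cR => [|s] cR; first by exists set0; rewrite sub0set; split=> // y z;
    rewrite inE.
case: (classic (exists S : {set T}, [/\ S \subset R, s.+1 <= #|S| & forall y z, y \in S ->
    z \in S -> y != z -> c [set y; z; x] = false])) => // none.
case: C cR np => [|C] cR np.
  by case/negP: np; apply/existsP; exists [tuple].
have [u uu us ind||p [up sp pp szp]] :=
    @long_path _ (link_rel c x) (enum R) s C (@link_rel_sym _ c x) (enum_uniq _).
- rewrite leqNgt; apply/negP => lt; case: none; exists [set z in u]; split.
  + by apply/subsetP => z; rewrite inE => /us; rewrite mem_enum.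
  + by rewrite cardsE (card_uniqP uu).
  + move=> y z; rewrite !inE => yu zu yz; have := ind y z yu zu yz.
    by rewrite /link_rel yz => /negbTE.
- by rewrite -cardE; move: cR; clear; nia.
case/negP: np; apply/existsP.
have sz : size (take C.+1 p) == C.+1 by rewrite size_takel.
exists (Tuple sz); rewrite /= take_uniq // take_sorted // andbT.
by apply/allP => z /mem_take /sp; rewrite mem_enum.
Qed.

(* The absence of a red path in the links passes to subsets of [R], so the classes
   can be treated one after the other, shrinking [R] each time. *)
Lemma common_blue_set (T : finType) (c : {set T} -> bool) (R : {set T}) (A : nat ->
    {set T}) k m C :
  m * C ^ k <= #|R| -> (forall i, i < k -> 2 ^ #|R| * m < #|A i|) ->
  (forall i x, i < k -> x \in A i -> ~~ link_path c C R x) ->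
  exists (S : {set T}) (A' : nat -> {set T}), [/\ S \subset R, m <= #|S|,
    forall i, i < k -> A' i \subset A i /\ m <= #|A' i| & forall i, i < k -> blue_arc c S (A' i)].
Proof.
elim: k R => [|k IH] R cR cA np; first by exists R, A; rewrite expn0 muln1 in cR; split.
pose blue x (S : {set T}) := [&& S \subset R, m * C ^ k <= #|S| & [forall y in S, forall z in S,
    (y != z) ==> ~~ c [set y; z; x]]].
have ex x : x \in A k -> exists S, blue x S.
  move=> xA; have [|S [sS cS bS]] := @link_indep T c R x C (m * C ^ k) _ (np k x (ltnSn k) xA).
    by rewrite -mulnA -expnSr.
  exists S; rewrite /blue sS cS; apply/forall_inP => y yS; apply/forall_inP => z zS.
  by apply/implyP => yz; rewrite bS.
pose f x := odflt set0 [pick S | blue x S].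
have fP x : x \in A k -> blue x (f x).
  by move/ex => [S bS]; rewrite /f; case: pickP => [//|/(_ S)]; rewrite bS.
(* There are at most [2 ^ #|R|] independent sets to choose from, so more than [m] vertices of the
   class [A k] share one. It replaces [R] for the other classes, at the cost of one factor [C]. *)
have [||S _ big] := @pigeonhole_set T _ f (A k) (powerset R) m.
- by move=> x /fP /and3P[]; rewrite inE.
- by rewrite card_powerset; apply: cA.
have /card_gt0P[x0] : 0 < #|[set x in A k | f x == S]| by apply: leq_ltn_trans big.
rewrite inE => /andP[/fP bx0 /eqP E]; rewrite E in bx0; case/and3P: bx0 => SR cS _.
have [||S' [A' [sS' cS' hA' bA']]] := IH S cS.
- move=> i ik; apply: leq_ltn_trans (cA i (ltnW ik)); rewrite leq_mul2r leq_exp2l //.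
  by rewrite subset_leq_card ?orbT.
- move=> i x ik xA; apply: contra (np i x (ltnW ik) xA) => /existsP[v /and3P[uv vS pv]].
  apply/existsP; exists v; rewrite uv pv andbT; apply/allP => z /(allP vS) /= zS;
      exact: (subsetP SR).
exists S', (fun i => if i == k then [set x in A k | f x == S] else A' i); split=> //.
- exact: subset_trans sS' SR.
- move=> i; rewrite ltnS leq_eqVlt; case: eqP => [-> _|_ /= /hA' //]; split; last exact: ltnW.
  by apply/subsetP => x; rewrite inE => /andP[].
- move=> i; rewrite ltnS leq_eqVlt; case: eqP => [_ _|_ /= /bA' //].
  move=> y z x /(subsetP sS') yS /(subsetP sS') zS yz; rewrite inE =>
      /andP[/fP/and3P[_ _ bl] /eqP Ex].
  move: bl; rewrite Ex => /forall_inP /(_ y yS) /forall_inP /(_ z zS).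
  by rewrite yz => /negbTE.
Qed.

(** A set in [R] independent in the links of many vertices of each class in [W] becomes the new
    first class. The classes in [W] are larger than [2 ^ #|Q| * m] because each loses vertices to a
    pigeonhole argument. *)
Lemma stuck_blueH (T : finType) (c : {set T} -> bool) (V Q R W : {set T}) k m C :
  Q \subset V -> R \subset Q -> m * C ^ k <= #|R| -> W \subset V -> [disjoint Q & W] ->
  (forall x, x \in W -> ~~ link_path c C R x) ->
  blueH c k (2 ^ #|Q| * m).+1 W -> blueH c k.+1 m V.
Proof.
move=> QV RQ cR WV dQW np [A [hA dA bA]].
have [||S [A' [sS cS hA' bA']]] := @common_blue_set T c R A k m C cR.
- move=> i /hA[_]; apply: leq_trans; rewrite ltnS leq_mul2r leq_exp2l //.
  by rewrite subset_leq_card ?orbT.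
- by move=> i x /hA[/subsetP sA _] /sA /np.
have sSQ : S \subset Q by exact: subset_trans sS RQ.
exists (fun i => if i is i'.+1 then A' i' else S); split=>
    [[|i] //= lt|[|i] [|j] //= ij|[|i] [|j] //= ij].
- by split=> //; apply: subset_trans QV.
- have [s1 ?] := hA' i lt; have [s2 _] := hA i lt; split=> //.
  by apply: subset_trans s1 _; apply: subset_trans WV.
- have [s1 ?] := hA' j ij; have [s2 _] := hA j ij.
  by apply: disjointW dQW => //; apply: subset_trans s2.
- have /andP[ij1 jk] := ij; have [s1 _] := hA' i (ltn_trans ij1 jk); have [s2 _] := hA' j jk.
  by apply: disjointW (dA _ _ ij).
- exact: bA'.
- have /andP[ij1 jk] := ij; have [s1 _] := hA' i (ltn_trans ij1 jk); have [s2 _] := hA' j jk.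
  by apply: blue_arcS (bA _ _ ij).
Qed.

(** * Transitive subtournaments *)

Lemma leastP_le (P : nat -> Prop) N : P N -> leastP P <= N.
Proof.
rewrite /leastP => PN; case: excluded_middle_informative => // h.
by case: ex_minnP => n _; apply; case: excluded_middle_informative.
Qed.

Lemma leastP_holds (P : nat -> Prop) N : P N -> P (leastP P).
Proof.
rewrite /leastP => PN; case: excluded_middle_informative => [h|[]].
  by case: ex_minnP => n; case: excluded_middle_informative.
by exists N; case: excluded_middle_informative.
Qed.

(** Either the out- or the in-neighbourhood of a vertex [v] holds half of the set; [v] is put first
    or last accordingly. *)
Lemma transitive_seq (M : nat) (T : rel 'I_M) k (A : {set 'I_M}) : is_tournament T ->
    2 ^ k <= #|A| ->
  exists s, [/\ size s = k.+1, uniq s, {subset s <= A} & pairwise T s].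
Proof.
move=> [irr tot]; elim: k A => [|k IH] A cA.
  have /card_gt0P[v vA] : 0 < #|A| by [].
  by exists [:: v]; split=> // z; rewrite inE => /eqP->.
have /card_gt0P[v vA] : 0 < #|A| by apply: leq_trans cA; rewrite expn_gt0.
pose O := [set z in A :\ v | T v z]; pose J := [set z in A :\ v | T z v].
have cc : #|A| <= (#|O| + #|J|).+1.
  rewrite (cardsD1 v A) vA ltnS; apply: leq_trans (leq_card_setU O J).
  apply: subset_leq_card; apply/subsetP => z zA; rewrite !inE in zA *; rewrite zA /=.
  by have := tot z v; rewrite (andP zA).1 => /(_ isT); case: (T z v); rewrite ?orbT ?orbF.
have [h|h] : 2 ^ k <= #|O| \/ 2 ^ k <= #|J|.
  move: cA cc; rewrite expnS; clear; case: (leqP (2 ^ k) #|O|); first by left.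
  by set x := 2 ^ k; clearbody x; right; lia.
  have [s [szs us sO ps]] := IH O h; exists (v :: s); split=> /=.
  - by rewrite szs.
  - by rewrite us andbT; apply/negP => /sO; rewrite !inE eqxx.
  - by move=> z; rewrite inE => /orP[/eqP->//|/sO]; rewrite !inE => /andP[/andP[]].
  - by rewrite ps andbT; apply/allP => z /sO; rewrite inE => /andP[].
have [s [szs us sJ ps]] := IH J h; exists (rcons s v); split.
- by rewrite size_rcons szs.
- by rewrite rcons_uniq us andbT; apply/negP => /sJ; rewrite !inE eqxx.
- by move=> z; rewrite mem_rcons inE => /orP[/eqP->//|/sJ]; rewrite !inE => /andP[/andP[]].
- by rewrite pairwise_rcons ps andbT; apply/allP => z /sJ; rewrite inE => /andP[].
Qed.

(** This guarantees that [leastP] does not return its default [0] in [tourn_ramsey]. *)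
Lemma forces_TT_exists k : forces_TT k (2 ^ k).
Proof.
move=> M le T tT; have [|s [szs us _ /pairwiseP ps]] := transitive_seq (k := k) (A := setT) tT.
  by rewrite cardsT card_ord.
case: s szs us ps => // x0 s szs us ps.
exists (fun i : 'I_k => nth x0 (x0 :: s) i); split.
  move=> i j /eqP; rewrite nth_uniq // ?szs ?(ltn_trans (ltn_ord _)) //.
  by move/eqP/val_inj.
by move=> i j ij; apply: (ps x0); rewrite // inE szs (ltn_trans (ltn_ord _)).
Qed.

Lemma forces_TT_tourn_ramsey k : forces_TT k (tourn_ramsey k).
Proof. exact: (@leastP_holds (forces_TT k) _ (@forces_TT_exists k)). Qed.

Lemma tourn_ramsey_gt k M (T : rel 'I_M) : is_tournament T -> ~ contains_TT T k ->
    M < tourn_ramsey k.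
Proof.
move=> tT no; rewrite ltnNge; apply/negP => le; apply: no.
exact: (forces_TT_tourn_ramsey le).
Qed.

Lemma tourn_ramsey_ge2 k : 2 <= k -> 2 <= tourn_ramsey k.
Proof.
move=> k2; apply: (@tourn_ramsey_gt k 1 (fun _ _ => false)).
  by split=> // i j; rewrite !ord1 eqxx.
case=> f [inj _]; have := inj (Ordinal (ltnW k2)) (Ordinal k2); rewrite !ord1 =>
    /(_ erefl) /(congr1 val) //.
Qed.

(* Add two vertices [u], [v] to a tournament with arcs from [u] to the old vertices, from
   these to [v], and from [v] to [u]: a transitive subtournament on at least three vertices
   cannot use both. *)
Lemma tourn_ramsey_step k : 2 <= k -> tourn_ramsey k + 2 <= tourn_ramsey k.+1.
Proof.
move=> k2.
(* By minimality of [tourn_ramsey k], some tournament on at least [tourn_ramsey k - 1] vertices has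
   no transitive subtournament of order [k]. *)
have [M [T [tT noT leM]]] : exists M (T : rel 'I_M), [/\ is_tournament T,
    ~ contains_TT T k & tourn_ramsey k <= M.+1].
  apply: NNPP => no; have := tourn_ramsey_ge2 k2.
  have : tourn_ramsey k <= (tourn_ramsey k).-1.
    apply: leastP_le => M leM T tT; apply: NNPP => noT; apply: no; exists M, T; split=> //.
    by move: leM; clear; lia.
  by clear; lia.
(* [insub] succeeds exactly on the old vertices; [M] plays the role of [u] and [M.+1] that of
   [v]. *)
pose E : rel 'I_M.+2 := fun i j =>
  match insub (i : nat), insub (j : nat) with
  | Some i', Some j' => T i' j'
  | None, Some _ => i == M :> nat
  | Some _, None => j == M.+1 :> nat
  | None, None => (i == M.+1 :> nat) && (j == M :> nat)
  end.
have nv (i : 'I_M.+2) : ~~ (i < M) -> i = M :> nat \/ i = M.+1 :> nat.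
  by move: (ltn_ord i); clear; lia.
have neF : (M == M.+1) = false by rewrite ltn_eqF.
have neF' : (M.+1 == M) = false by rewrite gtn_eqF.
suff: M.+2 < tourn_ramsey k.+1 by move: leM; clear; lia.
apply: (@tourn_ramsey_gt k.+1 M.+2 E).
  split=> [i|i j ne]; rewrite /E.
    case: insubP => [i' _ _|/nv h]; first exact: tT.1.
    by case: h => ->; rewrite ?neF ?neF' ?andbF.
  have nij : (i : nat) <> j by move/val_inj => e; rewrite e eqxx in ne.
  case: insubP => [i' iM ei|/nv hi]; case: insubP => [j' jM ej|/nv hj].
  - by apply: tT.2; apply/eqP => e; apply: nij; rewrite -ei -ej e.
  - by case: hj => ->; rewrite eqxx ?neF ?neF'.
  - by case: hi => ->; rewrite eqxx ?neF ?neF'.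
  - by case: hi hj nij => -> [] ->; rewrite ?eqxx ?neF ?neF'.
case=> f [injf hf].
(* [u], an old vertex and [v] form a cyclic triangle. *)
have cyc : forall i j l : 'I_k.+1, f i = M :> nat -> f j = M.+1 :> nat -> f l < M -> False.
  move=> i j l fi fj fl.
  have nij : i != j by apply/eqP => e; move: fi; rewrite e fj; clear; lia.
  have nil : i != l by apply/eqP => e; move: fi; rewrite e; move: fl; clear; lia.
  have njl : j != l by apply/eqP => e; move: fj; rewrite e; move: fl; clear; lia.
  have iM : insub (f i : nat) = None :> option 'I_M by rewrite insubF // fi ltnn.
  have jM : insub (f j : nat) = None :> option 'I_M by rewrite insubF // fj; apply/negbTE;
      rewrite -leqNgt.
  have Eij : E (f i) (f j) = false by rewrite /E iM jM fi neF.
  have Eli : E (f l) (f i) = false by rewrite /E iM insubT fi neF.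
  have Ejl : E (f j) (f l) = false by rewrite /E jM insubT fj neF'.
  have h1 : ~~ (i < j) by apply/negP => /hf; rewrite Eij.
  have h2 : ~~ (l < i) by apply/negP => /hf; rewrite Eli.
  have h3 : ~~ (j < l) by apply/negP => /hf; rewrite Ejl.
  move: h1 h2 h3 nij nil njl; rewrite -!val_eqE /=; clear; lia.
(* At most one vertex of the copy is new, since [k.+1 >= 3] would give two new ones an old
   companion. Omitting the index [i0] leaves [k] old vertices. *)
have [i0 hi0] : exists i0 : 'I_k.+1, forall j : 'I_k, f (lift i0 j) < M.
  case: (pickP (fun i => ~~ (f i < M))) => [i0 big|none]; last first.
    by exists ord0 => j; apply: negbNE; rewrite none.
  exists i0 => j; apply: negbNE; apply/negP => big'.
  have ne : i0 != lift i0 j by apply: neq_lift.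
  have [l [li lj]] : exists l : 'I_k.+1, l != i0 /\ l != lift i0 j.
    have : 0 < #|~: [set i0; lift i0 j]|.
      by rewrite cardsCs setCK card_ord cards2 ne; move: k2; clear; lia.
    by case/card_gt0P => l; rewrite !inE negb_or => /andP[? ?]; exists l.
  have nf (a b : 'I_k.+1) : a != b -> (f a : nat) <> f b by move=> ab /val_inj/injf e;
      rewrite e eqxx in ab.
  have n1 := nf _ _ ne; have n2 := nf _ _ li; have n3 := nf _ _ lj.
  have fl : f l < M.
    apply: negbNE; apply/negP => /nv hl.
    by move: (nv _ big) (nv _ big') hl n1 n2 n3; clear; lia.
  case: (nv _ big) (nv _ big') => e1 [] e2.
  - by apply: n1; rewrite e1 e2.
  - exact: cyc e1 e2 fl.
  - exact: cyc e2 e1 fl.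
  - by apply: n1; rewrite e1 e2.
apply: noT; exists (fun j => Ordinal (hi0 j)); split.
  by move=> a b /(congr1 val) /= /val_inj /injf /lift_inj.
move=> a b ab; have : E (f (lift i0 a)) (f (lift i0 b)).
  by apply: hf; rewrite /= /bump; move: ab; clear; lia.
by rewrite /E (insubT (fun x => x < M) (hi0 a)) (insubT (fun x => x < M) (hi0 b)).
Qed.

Lemma tourn_ramsey2 : tourn_ramsey 2 = 2.
Proof.
apply/eqP; rewrite eqn_leq tourn_ramsey_ge2 // andbT; apply: leastP_le => M le T [irr tot].
pose i0 := Ordinal (ltnW le); pose i1 := Ordinal le.
have H (a b : 'I_M) : a != b -> T a b -> contains_TT T 2.
  move=> ab Tab; exists (fun i : 'I_2 => if i == ord0 then a else b); split.
    have one (i : 'I_2) : i <> ord0 -> i = ord_max.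
      by move=> ne; apply: val_inj; case: i ne => [[|[|]]] //= ? [] ; apply: val_inj.
    move=> i j; case: eqP => [->|/one ->]; case: eqP => [->|/one ->] // e;
        by rewrite e eqxx in ab.
  by move=> i j; case: i => [[|[|]]] //= ?; case: j => [[|[|]]].
have ne : i0 != i1 by [].
have := tot i0 i1 ne; case E: (T i0 i1) => /=; first by move=> _; apply: H E.
by move=> E'; apply: H E'; rewrite eq_sym.
Qed.

(** * The Ramsey bound *)

(* [1 / q] plays the role of [eps]; the case [k > 2] reads [(2/3 + 1/(3q)) (R(k) - 1) n <= N]. *)
Definition ramsey_bound k q n N :=
  if k == 2 then q.+1 * n <= q * N
  else q.*2.+1 * ((tourn_ramsey k - 1) * n) <= 3 * q * N.

Lemma redpath_le (T : finType) (c : {set T} -> bool) (n n' : nat) (V W : {set T}) :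
  n' <= n -> W \subset V -> redpath c n W -> redpath c n' V.
Proof.
move=> le sW [s [us szs sV ts]]; exists s; split=> //; first exact: leq_trans szs.
by move=> z /sV /(subsetP sW).
Qed.

Lemma linked_chain_redpath (T : finType) (c : {set T} -> bool) (V : {set T}) t B ell Q Qs :
  4 <= t <= ell -> clique_family c V t (Q :: Qs) -> path (linked c) Q Qs ->
  (forall X, X \in Q :: Qs -> fillable c V X B ell) -> ell * (size Qs).+1 <= B ->
  redpath c (ell * (size Qs).+1) V.
Proof.
move=> tell fam pth fill szB; have [_ /(_ Q (mem_head _ _))[_ cQ _] _] := fam.
have [x [y [xQ yQ xy]]] : exists x y, [/\ x \in Q, y \in Q & x != y].
  by apply: card_ge2P; rewrite cQ; case/andP: tell => /(leq_trans _) h _; apply: h.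
have up : uniq ([::] ++ [:: x; y]) by rewrite /= inE xy.
by have := chain_tight tell fam pth fill up xQ yQ; apply.
Qed.

(** Here [r = 1]: a single chain of red cliques, each traversed completely, carries the path. *)
Lemma ramsey_bound2 m q : 0 < m -> 0 < q -> exists n0, forall n, n0 <= n ->
  forall (T : finType) (c : {set T} -> bool) (V : {set T}), ramsey_bound 2 q n #|V| ->
  redpath c n V \/ blueH c 2 m V.
Proof.
move=> m0 q0; have forc : forces_TT 2 2 by rewrite -{2}tourn_ramsey2;
    apply: forces_TT_tourn_ramsey.
have [t0 ht] := linked_chain m0 forc.
have [||L hL] := ht (maxn t0 4); rewrite ?leq_maxl ?leq_max ?orbT //.
set t := maxn t0 4 in hL; have t4 : 4 <= t by rewrite leq_maxr.
(* With this threshold the overhead [L] is at most [n / q]. *)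
exists (q * L) => n le T c V; rewrite /ramsey_bound /= => cond.
have [|//|[Q [Qs [fam pth szQs]]]] := hL T c V (n %/ t); [|by right|left].
  have := leq_trunc_div n t; rewrite mul1n mulnC => h.
  rewrite -(leq_pmul2l q0); apply: leq_trans cond; rewrite mulnDr mulSn.
  by apply: leq_add => //; rewrite leq_mul2l h orbT.
have := @linked_chain_redpath T c V t (t * (size Qs).+1) t Q Qs.
case=> // [|X Xin|s hs]; first by rewrite t4 leqnn.
  by have [_ /(_ X Xin)[mX <- _] _] := fam; apply: fillable_clique.
apply: (@redpath_le _ _ (t * (size Qs).+1) _ V V) => //; last by exists s.
by rewrite szQs mulnC; apply/ltnW/ltn_ceil; apply: leq_trans t4.
Qed.

Lemma tourn_ramsey_bound_ge k : 2 <= k -> 3 <= tourn_ramsey k.+1 - 1.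
Proof. by move=> k2; have := tourn_ramsey_step k2; have := tourn_ramsey_ge2 k2; lia. Qed.

(** Deleting [n + D] vertices is paid for by [tourn_ramsey k + 2 <= tourn_ramsey k.+1], as two units
    are worth more than [4n/3]. If [k = 2], then [N] is at least [(2 + 1/q) n], and doubling [q]
    makes room for [D]. *)
Lemma ramsey_bound_step k q n N D : 2 <= k -> 0 < q -> 4 * q * D <= n ->
  ramsey_bound k.+1 q n N -> [/\ n + D <= N & ramsey_bound k q.*2 n (N - n - D)].
Proof.
move=> k2 q0 big; rewrite /ramsey_bound eqSS (_ : (k == 1) = false); last by case: k k2 => [|[]].
have r3 := tourn_ramsey_bound_ge k2.
have r2 : tourn_ramsey k - 1 + 2 <= tourn_ramsey k.+1 - 1.
  by have := tourn_ramsey_step k2; have := tourn_ramsey_ge2 k2; lia.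
set r := tourn_ramsey k.+1 - 1 in r2 r3 *; set r' := tourn_ramsey k - 1 in r2 *.
clearbody r r' => cond.
have h1 : q.*2.+1 * n <= q * N by nia.
have h2 : n + D <= N by nia.
split=> //; case: eqP => _.
  suff: q.*2.+1 * n + q.*2 * (n + D) <= q.*2 * N by nia.
  nia.
have h3 : q.*2.+1 * ((r' + 2) * n) <= 3 * q * N by nia.
suff: q.*2.*2.+1 * (r' * n) + 3 * q.*2 * (n + D) <= 3 * q.*2 * N by nia.
nia.
Qed.

(** The statement concerns subsets [V] of any finite type, with [m] and [q] free, so that the
    induction hypothesis applies to leftover vertices with larger classes and a smaller epsilon. *)
Lemma red_path_or_blue k m q : 2 <= k -> 0 < m -> 0 < q -> exists n0, forall n, n0 <= n ->
  forall (T : finType) (c : {set T} -> bool) (V : {set T}), ramsey_bound k q n #|V| ->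
  redpath c n V \/ blueH c k m V.
Proof.
move=> k2; elim: k k2 m q => // k IH; rewrite leq_eqVlt => /orP[/eqP <- |k2] m q m0 q0.
  exact: ramsey_bound2.
rewrite ltnS in k2.
have r3 := tourn_ramsey_bound_ge k2.
pose r := tourn_ramsey k.+1 - 1.
have forc : forces_TT k.+1 r.+1.
  rewrite (_ : r.+1 = tourn_ramsey k.+1); first exact: forces_TT_tourn_ramsey.
  by move: r3; rewrite /r; clear; lia.
have [t0 ht] := linked_chain m0 forc.
(* A block of [3K - 1] vertices spends [2K] vertices of its clique. With [K = 4q + 2] and [j] large
   against [t2], this gives [t / ell <= 2/3 + 1/(6q)]. The value [t2] is the size of [R] required by
   [stuck_blueH]. *)
pose K := q.*2.*2 + 2; pose t2 := m * K.*2 ^ k; pose j := t0 + 6 * q * (t2 + 4).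
pose t := K.*2 * j + t2 + 4; pose ell := j * (3 * K).-1 + 4.
have jt0 : t0 <= j by rewrite leq_addr.
have jt2 : 6 * q * (t2 + 4) <= j by rewrite leq_addl.
have K0 : 0 < K by rewrite /K addn2.
have tt0 : t0 <= t.
  by apply: leq_trans jt0 _; rewrite /t -addnA; apply: leq_trans (leq_addr _ _);
      apply: leq_pmull; rewrite double_gt0.
have t4 : 4 <= t by rewrite leq_addl.
have tell : t <= ell by rewrite /t /ell; move: jt2 q0; rewrite /K; clear; nia.
have ratio : 6 * q * t <= (4 * q + 1) * ell.
  by rewrite /t /ell; move: jt2 q0; rewrite /K; clear; nia.
have [//||L hL] := ht t; first exact: leq_trans t4.
have [n1 hn1] := IH k2 (2 ^ t * m).+1 q.*2 isT ltac:(by rewrite double_gt0).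
(* [D] bounds what [fillable_or_stuck] loses beyond [n]; its first term covers [B - n]. *)
pose D := ell + 3 * K * j + 2 ^ (2 ^ t) * K.
exists (n1 + 6 * q * L + 4 * q * D) => n big T c V cond.
have [h1 h2] : [/\ n + D <= #|V| & ramsey_bound k q.*2 n (#|V| - n - D)].
  by apply: ramsey_bound_step cond => //; move: big; clear; lia.
pose B := ell * (n %/ ell).+1.
have ell0 : 0 < ell by rewrite /ell addn_gt0 orbT.
have nB : n <= B by rewrite /B mulnC; apply/ltnW/ltn_ceil.
have Bn : B <= n + ell by rewrite /B mulnS addnC leq_add2r mulnC leq_trunc_div.
have [|//|[Q [Qs [fam pth szQs]]]] := hL T c V (n %/ ell); [|by right|].
  move: cond; rewrite /ramsey_bound eqSS (_ : (k == 1) = false); last by move: k2; clear;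
      case: k => [|[]].
  rewrite -/r => cond; have h := leq_trunc_div n ell.
  have r1 : 0 < r by apply: leq_trans r3.
  have nL : 6 * q * L <= n by move: big; clear; lia.
  have h3 : 6 * q * (t * (n %/ ell)) <= (4 * q + 1) * n.
    rewrite mulnA; apply: leq_trans (leq_mul ratio (leqnn _)) _.
    by rewrite -mulnA leq_mul2l (mulnC ell) h orbT.
  have h4 : 6 * q * (t * (r * (n %/ ell))) <= (4 * q + 1) * (r * n).
    by have := leq_mul (leqnn r) h3; clear; set x := n %/ ell; clearbody x; nia.
  (* The cliques need at most [(2/3 + 1/(6q)) r n] vertices; the remaining [r n / (6q)] of the bound
     pays for [L]. *)
  have nLr : 6 * q * L <= r * n by apply: leq_trans nL _; apply: leq_pmull.
  have : 6 * q * (L + t * (r * (n %/ ell))) <= 6 * q * #|V|.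
    by move: h4 nLr cond; rewrite mulnDr; clear; lia.
  by rewrite leq_mul2l muln_eq0 (gtn_eqF q0).
(* A stuck clique leaves [#|V| - n - D] outside vertices to the induction hypothesis and adds a
   class to the blue copy found there. Otherwise every clique of the chain is fillable. *)
case: (classic (exists2 X, X \in Q :: Qs & stuck c V X K.*2 t2 (#|V| - n - D))) => [[X Xin]|nst].
  have [_ /(_ X Xin)[mX cX XV] _] := fam.
  case=> R [W [[RX cR WV dXW] cW np]].
  have [||rp|bl] := hn1 n _ T c W.
  - by move: big; clear; lia.
  - move: h2; rewrite /ramsey_bound; case: ifP => _ h; apply: leq_trans h _;
      by rewrite leq_mul2l cW orbT.
  - by left; apply: redpath_le rp.
  - by right; apply: (@stuck_blueH T c V X R W k m K.*2) => //; rewrite cX.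
left; apply: (@redpath_le _ _ (ell * (size Qs).+1) _ V V) => //; first by rewrite szQs.
apply: (@linked_chain_redpath T c V t B ell Q Qs) => //; rewrite ?t4 ?szQs //.
move=> X Xin; have [_ /(_ X Xin)[mX cX XV] _] := fam.
have [||//|st] := @fillable_or_stuck T c V X K j t2 (#|V| - n - D) B K0 mX.
- by rewrite cX.
- rewrite cX; move: h1 Bn; rewrite /D; clear; set u := #|V|; set z := 2 ^ (2 ^ t) * K;
    clearbody u z; lia.
- by case: nst; exists X.
Qed.

(** * Transfer to colourings, Ramsey numbers and real bounds *)

Lemma tight_nth (T : finType) (c : {set T} -> bool) (x0 : T) (s : seq T) i : tight c s ->
    i.+2 < size s ->
  c [set nth x0 s i; nth x0 s i.+1; nth x0 s i.+2].
Proof.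
elim: s i => // x s IH [|i] /= /andP[h ts] lt; last exact: IH.
by case: s h lt {IH ts} => [|y [|z s]].
Qed.

Lemma imset_set3 (aT rT : finType) (f : aT -> rT) x y z : f @: [set x; y; z] = [set f x; f y;
    f z].
Proof. by rewrite !imsetU !imset_set1. Qed.

Lemma redpath_mono_copy N (c : colouring N) n (V : {set 'I_N}) :
  redpath c n V -> has_mono_copy c true (tight_path n).
Proof.
case=> s [us szs _ ts]; case: N c V s us szs ts => [|N] c V s us szs ts.
  have s0 : s = [::] by case: s {us szs ts} => // -[].
  have n0 : n = 0 by move: szs; rewrite s0; case: n.
  subst n; exists (fun i : 'I_0 => i); split=> // e.
  by rewrite inE => /existsP[[]].
exists (fun i : 'I_n => nth ord0 s i); split.
  move=> i j /eqP; rewrite nth_uniq ?(leq_trans (ltn_ord _)) // => /eqP; exact: val_inj.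
move=> e; rewrite inE => /existsP[i /existsP[j /existsP[k /and3P[/eqP ij /eqP ik /eqP->]]]].
rewrite imset_set3 ij ik; apply: tight_nth => //.
by rewrite -ik; apply: leq_trans szs.
Qed.

Lemma blueH_mono_copy N (c : colouring N) k m (V : {set 'I_N}) : 0 < N ->
  blueH c k m V -> has_mono_copy c false (Hblowup m (@TT k)).
Proof.
case: N c V => // N c V _ [A [hA dA bA]].
pose f (x : 'I_k * 'I_m) := nth ord0 (enum (A x.1)) x.2.
have szA (i : 'I_k) (j : 'I_m) : j < size (enum (A i)).
  by rewrite -cardE; apply: leq_trans (ltn_ord j) _; have [] := hA i (ltn_ord i).
have fA x : f x \in A x.1 by rewrite -mem_enum; apply: mem_nth.
have dis (i j : 'I_k) : i != j -> [disjoint A i & A j].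
  rewrite neq_ltn => /orP[] lt; last rewrite disjoint_sym; by apply: dA; rewrite lt ltn_ord.
have injf : injective f.
  move=> x y exy; have e1 : x.1 = y.1.
    apply/eqP; apply: contraT => /dis d; have := fA x; rewrite (disjointFl d) //.
    by rewrite exy.
  move: x y e1 exy => [i a] [j b] /= <- /eqP; rewrite nth_uniq ?enum_uniq // => /eqP e.
  by congr (_, _); apply: val_inj.
exists f; split=> // e; rewrite inE.
case/existsP=> x /existsP[y /existsP[z /and4P[xy /eqP e1 lt /eqP->]]].
rewrite imset_set3; apply: (bA x.1 z.1) => //.
- by apply/andP; split; [exact: lt | exact: ltn_ord].
- by rewrite e1.
- by rewrite (inj_eq injf).
Qed.

Lemma ramsey3_le k m q : 2 <= k -> 0 < m -> 0 < q -> exists n0, forall n N, n0 <= n -> 0 < N ->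
  ramsey_bound k q n N -> ramsey3 (tight_path n) (Hblowup m (@TT k)) <= N.
Proof.
move=> k2 m0 q0; have [n0 hn0] := red_path_or_blue k2 m0 q0.
exists n0 => n N le N0 cond; apply: leastP_le => c.
have [|h|h] := hn0 n le _ c setT; first by rewrite cardsT card_ord.
  by left; apply: redpath_mono_copy h.
by right; apply: blueH_mono_copy h.
Qed.

Lemma nat_floor (x : R) : Rle 0 x -> exists N : nat, Rle (INR N) x /\ Rlt x (INR N + 1).
Proof.
move=> x0; have [h1 h2] := archimed x.
have up0 : Z.lt 0 (up x) by apply: lt_IZR; lra.
exists (Z.to_nat (up x - 1)); rewrite INR_IZR_INZ Z2Nat.id; last by move: up0; clear; lia.
by rewrite minus_IZR; split; lra.
Qed.

Theorem theorem1p14 :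
  forall (chi m : nat) (eps : R), 2 <= chi -> 2 <= m -> Rlt 0 eps ->
  exists n0 : nat, forall n : nat, n0 <= n ->
    Rle (INR (ramsey3 (tight_path n) (Hblowup m (@TT chi))))
        (if chi == 2 then Rmult (Rplus 1 eps) (INR n)
         else Rmult (Rmult (Rplus (Rdiv 2 3) eps) (INR (tourn_ramsey chi - 1))) (INR n)).
Proof.
move=> chi m eps chi2 m2 eps0.
(* [1 / q] stands in for [eps]; the factor [2] leaves room for rounding the real bound down to an
   integer [N]. *)
have [q [q0 hq]] : exists q : nat, 0 < q /\ Rlt 2 (Rmult (INR q) eps).
  have [N [_ hN]] := nat_floor (x := Rdiv 2 eps) ltac:(apply: Rlt_le; apply: Rdiv_lt_0_compat;
      lra).
  exists N.+1; split=> //; rewrite S_INR.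
  by apply: (Rmult_lt_reg_r (/ eps)); [apply: Rinv_0_lt_compat | rewrite Rmult_assoc Rinv_r; lra].
have [n0 hn0] := ramsey3_le chi2 (ltnW m2) q0.
exists (n0 + 3 * q + 3) => n big.
have nR : Rle (3 * INR q + 3) (INR n).
  have -> : Rplus (Rmult 3 (INR q)) 3 = INR (3 * q + 3) by rewrite plus_INR mult_INR /=; lra.
  by apply: le_INR; move: big; clear; lia.
have qR : Rle 1 (INR q) by apply: (le_INR 1); apply/leP.
set x := (X in Rle _ X).
(* This makes [N] positive, so that ['I_N] has a default vertex. *)
have x1 : Rle 1 x.
  rewrite /x; case: ifP => _; first by nra.
  have : Rle 1 (INR (tourn_ramsey chi - 1)).
    by apply: (le_INR 1); apply/leP; have := tourn_ramsey_ge2 chi2; clear; lia.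
  set r := INR (tourn_ramsey _ - 1) => r1.
  have rn : Rle (INR n) (Rmult r (INR n)) by clear -r1 nR qR; nra.
  have ey : Rle 0 (Rmult eps (Rmult r (INR n))) by apply: Rmult_le_pos; lra.
  by rewrite Rmult_assoc; clearbody r; clear -rn ey nR qR; nra.
have [N [N1 N2]] := nat_floor (x := x) ltac:(lra).
apply: Rle_trans N1; apply/le_INR/leP; apply: hn0; first by move: big; clear; lia.
  by apply/ltP/INR_lt; rewrite /=; lra.
move: N2; rewrite /ramsey_bound /x; case: ifP => _ N2.
  apply/leP/INR_le; rewrite !mult_INR S_INR.
  have h : Rle (2 * INR n) ((INR q * eps) * INR n) by apply: Rmult_le_compat_r; lra.
  have h2 : Rlt (INR q * ((1 + eps) * INR n)) (INR q * (INR N + 1)) by apply: Rmult_lt_compat_l;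
      lra.
  by clear -h h2 nR qR; nra.
set r := tourn_ramsey chi - 1 in N2 *.
have r1 : Rle 1 (INR r).
  by apply: (le_INR 1); apply/leP; rewrite /r; have := tourn_ramsey_ge2 chi2; clear; lia.
apply/leP/INR_le; rewrite !mult_INR S_INR -addnn plus_INR.
have rn : Rle (INR n) (INR r * INR n) by clear -r1 nR qR; nra.
rewrite [INR 3]/=.
rewrite Rmult_assoc in N2.
move: (Rmult (INR r) (INR n)) rn N2 => y rn N2.
have h : Rle (2 * y) ((INR q * eps) * y) by apply: Rmult_le_compat_r; lra.
have h2 : Rlt (INR q * ((2 / 3 + eps) * y)) (INR q * (INR N + 1)) by apply: Rmult_lt_compat_l;
    lra.
clear -h h2 nR qR rn; nra.
Qed.
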